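(* For every positive integer $j$, \begin{align*} \sum_{n=0}^{\infty}p_{-7}\left(5^{2j-1}n+\frac{13\cdot5^{2j-1}+7}{24}\right)q^{n}&=\sum_{l=1}^{\infty}c(2j-1,l)\,q^{l-1}\frac{E_{5}^{6l-1}}{E_{1}^{6l+6}},\\ \sum_{n=0}^{\infty}p_{-7}\left(5^{2j}n+\frac{17\cdot5^{2j}+7}{24}\right)q^{n}&=\sum_{l=1}^{\infty}c(2j,l)\,q^{l-1}\frac{E_{5}^{6l}}{E_{1}^{6l+7}}. \end{align*}
   Context: $\sum_{n\geq0}p_{-7}(n)q^n=\prod_{i\geq1}(1-q^i)^{-7}$ ($7$-colored partitions), and $E_j:=\prod_{n\geq1}(1-q^{jn})$. The integers $m(i,j)$ ($i,j\geq1$) are defined by: $m(1,1)=5$, $m(2,1)=10$, $m(3,1)=9$, $m(4,1)=4$, $m(5,1)=1$, $m(i,1)=0$ for $i\geq6$; and for $j\geq2$, $i\geq1$, $m(i,j)=25m(i-1,j-1)+25m(i-2,j-1)+15m(i-3,j-1)+5m(i-4,j-1)+m(i-5,j-1)$, with $m(i',j')=0$ whenever $i'\leq0$. The integers $c(j,k)$ are defined by $c(1,1)=140$, $c(1,2)=49\cdot5^4$, $c(1,3)=21\cdot5^7$, $c(1,4)=91\cdot5^8$, $c(1,5)=7\cdot5^{11}$, $c(1,6)=5^{13}$, $c(1,k)=0$ for $k\geq7$, and $c(j+1,k)=\sum_{i\geq1}c(j,i)m(6i+6,i+k+1)$ if $j$ is odd, $c(j+1,k)=\sum_{i\geq1}c(j,i)m(6i+7,i+k+1)$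 if $j$ is even. *)

(* Defs.v *)
From HB Require Import structures.
From mathcomp Require Import all_boot all_order all_algebra.
From mathcomp Require Import boolp classical_sets functions cardinality fsbigop.
From mathcomp Require Import zify.

Set Implicit Arguments.
Unset Strict Implicit.
Unset Printing Implicit Defensive.

Import Order.TTheory GRing.Theory Num.Theory.

Local Open Scope ring_scope.

Record fps (R : Type) := FPS { fps_coef :> nat -> R }.

Lemma fpsP R (a b : fps R) : a = b <-> forall n, a n = b n.
Proof.
split=> [->//|]; case: a => a; case: b => b /= ab.
by congr FPS; apply/funext.
Qed.

HB.instance Definition _ (R : Type) := gen_eqMixin (fps R).
HB.instance Definition _ (R : Type) := gen_choiceMixin (fps R).

Section Ring.
Variable R : comNzRingType.
Implicit Types a b c : fps R.

Definition fps_zero : fps R := FPS (fun=> 0).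
Definition fps_opp a : fps R := FPS (fun n => - a n).
Definition fps_add a b : fps R := FPS (fun n => a n + b n).
Definition fps_one : fps R := FPS (fun n => (n == 0%N)%:R).
Definition fps_mul a b : fps R :=
  FPS (fun n => \sum_(i < n.+1) a i * b (n - i)%N).

Lemma fps_addA : associative fps_add.
Proof. by move=> a b c; apply/fpsP => n /=; rewrite addrA. Qed.
Lemma fps_addC : commutative fps_add.
Proof. by move=> a b; apply/fpsP => n /=; rewrite addrC. Qed.
Lemma fps_add0 : left_id fps_zero fps_add.
Proof. by move=> a; apply/fpsP => n /=; rewrite add0r. Qed.
Lemma fps_addN : left_inverse fps_zero fps_opp fps_add.
Proof. by move=> a; apply/fpsP => n /=; rewrite addNr. Qed.

HB.instance Definition _ :=
  GRing.isZmodule.Build (fps R) fps_addA fps_addC fps_add0 fps_addN.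

Let trunc N a : {poly R} := \poly_(i < N) a i.

Let coef_trunc N a i : (i < N)%N -> (trunc N a)`_i = a i.
Proof. by move=> iN; rewrite coef_poly iN. Qed.

Let coef_truncM N a b n : (n < N)%N ->
  (trunc N a * trunc N b)`_n = fps_mul a b n.
Proof.
move=> nN; rewrite coefM; apply: eq_bigr => i _.
by rewrite !coef_trunc // (leq_ltn_trans _ nN) // ?leq_subr// -ltnS.
Qed.

Lemma fps_mulC : commutative fps_mul.
Proof.
by move=> a b; apply/fpsP => n; rewrite -!(@coef_truncM n.+1)// mulrC.
Qed.

Lemma fps_mulA : associative fps_mul.
Proof.
move=> a b c; apply/fpsP => n.
transitivity (trunc n.+1 a * (trunc n.+1 b * trunc n.+1 c))`_n.
  rewrite coefM; apply: eq_bigr => i _.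
  by rewrite coef_trunc// coef_truncM// ltnS leq_subr.
rewrite mulrA coefM; apply: eq_bigr => i _.
by rewrite coef_truncM// coef_trunc// ltnS leq_subr.
Qed.

Lemma fps_mul1 : left_id fps_one fps_mul.
Proof.
move=> a; apply/fpsP => n /=.
by rewrite big_ord_recl/= mul1r subn0 big1 ?addr0// => i _; rewrite mul0r.
Qed.

Lemma fps_mulDl : left_distributive fps_mul fps_add.
Proof.
move=> a b c; apply/fpsP => n /=; rewrite -big_split.
by apply: eq_bigr => i _; rewrite mulrDl.
Qed.

Lemma fps_oner_neq0 : fps_one != 0.
Proof. by apply/eqP => /fpsP /(_ 0%N) /= /eqP; rewrite oner_eq0. Qed.

HB.instance Definition _ := GRing.Zmodule_isComNzRing.Build (fps R)
  fps_mulA fps_mulC fps_mul1 fps_mulDl fps_oner_neq0.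

Definition fps_unit : {pred fps R} := fun a => `[< exists b, b * a = 1 >].
Definition fps_inv a : fps R := xget a [set b | b * a = 1].

Lemma fps_mulV : {in fps_unit, left_inverse 1 fps_inv *%R}.
Proof. by move=> a /asboolP ua; exact: (@xgetPex _ a [set b | b * a = 1]). Qed.
Lemma fps_unitP a b : b * a = 1 -> fps_unit a.
Proof. by move=> ba; apply/asboolP; exists b. Qed.
Lemma fps_inv_out : {in [predC fps_unit], fps_inv =1 id}.
Proof.
move=> a; rewrite inE => na; rewrite /fps_inv xgetPN// => b /= ba.
by move/negP: na; apply; apply: fps_unitP ba.
Qed.

HB.instance Definition _ := GRing.ComNzRing_hasMulInverse.Build (fps R)
  fps_mulV fps_unitP fps_inv_out.

Definition fpsXn (k : nat) : fps R := FPS (fun n => (n == k)%:R).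

(** [fps_cvg u l]: each coefficient of [u N] is eventually that of [l]
    (the q-adic topology); [fps_lim u] is [0] if there is no limit. *)
Definition fps_cvg (u : nat -> fps R) (l : fps R) : Prop :=
  forall n, exists N0, forall N, (N0 <= N)%N -> u N n = l n.

Definition fps_lim (u : nat -> fps R) : fps R := xget 0 [set l | fps_cvg u l].

Definition sum_ge1 (u : nat -> fps R) : fps R :=
  fps_lim (fun N => \sum_(1 <= i < N) u i).

Definition prod_ge1 (u : nat -> fps R) : fps R :=
  fps_lim (fun N => \prod_(1 <= i < N) u i).

End Ring.

Notation "''q^' k" := (fpsXn _ k) (at level 1, k at level 2, format "''q^' k").

Section Theory.
Variable R : comNzRingType.
Implicit Types a b c d l : fps R.

Lemma fps_coefM a b n : (a * b) n = \sum_(i < n.+1) a i * b (n - i)%N.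
Proof. by []. Qed.

Lemma fps_coefD a b n : (a + b) n = a n + b n.
Proof. by []. Qed.

Lemma fps_coefB a b n : (a - b) n = a n - b n.
Proof. by []. Qed.

Lemma fps_limE (u : nat -> fps R) l : fps_cvg u l -> fps_lim u = l.
Proof.
move=> ul; apply: xget_unique => // l' ul'; apply/fpsP => n.
have [N1 e1] := ul n; have [N2 e2] := ul' n.
by rewrite -(e1 (maxn N1 N2)) ?leq_maxl// e2 ?leq_maxr.
Qed.

Definition fps_eqmod n a b := forall k, (k < n)%N -> a k = b k.

Lemma fps_eqmodM n a b c d :
  fps_eqmod n a b -> fps_eqmod n c d -> fps_eqmod n (a * c) (b * d).
Proof.
move=> ab cd k kn; rewrite !fps_coefM; apply: eq_bigr => i _.
rewrite ab ?cd// (leq_ltn_trans _ kn)// ?leq_subr//.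
by rewrite -ltnS.
Qed.

Lemma fps_cvg_diag (u : nat -> fps R) :
  (forall N, fps_eqmod N (u N.+1) (u N)) ->
  fps_cvg u (FPS (fun n => u n.+1 n)).
Proof.
move=> uS n; exists n.+1 => N /subnK <- /=.
by elim: (N - _)%N => //= k IH; rewrite addSn uS// addnS ltnS leq_addl.
Qed.

Lemma sum_ge1_cvg (u : nat -> fps R) : (forall i, fps_eqmod i.-1 (u i) 0) ->
  fps_cvg (fun N => \sum_(1 <= i < N) u i) (sum_ge1 u).
Proof.
move=> u0; have uS N : fps_eqmod N (\sum_(1 <= i < N.+2) u i)
    (\sum_(1 <= i < N.+1) u i).
  by move=> k kN; rewrite big_nat_recr// fps_coefD u0// addr0.
have := fps_cvg_diag uS; set l := FPS _ => /= h.
suff ul : fps_cvg (fun N => \sum_(1 <= i < N) u i) l.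
  by rewrite /sum_ge1 (fps_limE ul).
move=> n; have [N0 hN] := h n; exists N0.+1 => -[//|N]; apply: hN.
Qed.

Lemma fps_eqmodMq k a : fps_eqmod k ('q^k * a) 0.
Proof.
move=> n nk; rewrite fps_coefM big1// => i _ /=.
by rewrite ltn_eqF ?mul0r// (leq_ltn_trans _ nk)// -ltnS.
Qed.

Lemma sum_ge1_cvgMq (a : nat -> int) (d : nat -> fps R) :
  let u (l : nat) := (a l)%:~R * 'q^(l - 1) * d l in
  fps_cvg (fun N => \sum_(1 <= l < N) u l) (sum_ge1 u).
Proof.
move=> u; apply: sum_ge1_cvg => l.
by rewrite /u -mulrA mulrCA -subn1; apply: fps_eqmodMq.
Qed.

Lemma prod_ge1_cvg (u : nat -> fps R) : (forall i, fps_eqmod i (u i) 1) ->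
  fps_cvg (fun N => \prod_(1 <= i < N) u i) (prod_ge1 u).
Proof.
move=> u1; have uS N : fps_eqmod N (\prod_(1 <= i < N.+1) u i)
    (\prod_(1 <= i < N) u i).
  move=> k kN; rewrite big_nat_recr ?(leq_ltn_trans _ kN)//.
  by rewrite (@fps_eqmodM N _ (\prod_(1 <= i < N) u i) _ 1)// mulr1.
by have h := fps_cvg_diag uS; rewrite /prod_ge1 (fps_limE h).
Qed.

Lemma fps_eqmodX0 a k : a 0%N = 0 -> fps_eqmod k (a ^+ k) 0.
Proof.
move=> a0; elim: k => // k IH n nk.
rewrite exprS fps_coefM big1// => -[[|i] /= iP] _; first by rewrite a0 mul0r.
rewrite IH ?mulr0// subnS prednK ?subn_gt0//.
by rewrite leq_subLR (leq_trans (n := k))// leq_addl.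
Qed.

Lemma fps_unit1 a : a 0%N = 1 -> a \is a GRing.unit.
Proof.
move=> a0; set b := 1 - a.
have b0 : b 0%N = 0 by rewrite /b fps_coefB a0 subrr.
pose S N := \sum_(i < N) b ^+ i.
have SS N : fps_eqmod N (S N.+1) (S N).
  move=> k kN; rewrite /S big_ord_recr fps_coefD fps_eqmodX0 ?addr0//.
have := fps_cvg_diag SS; set l := FPS _ => Sl.
suff la : l * a = 1 by apply/unitrP; exists l; rewrite [a * l]mulrC.
have ab : a = 1 - b by rewrite /b opprB addrC subrK.
apply/fpsP => n.
have Sn M : fps_eqmod M l (S M).
  elim: M => // M IH k; rewrite ltnS leq_eqVlt => /orP[/eqP-> //|kM].
  by rewrite SS// IH.
have Sa : S n.+1 * a = 1 - b ^+ n.+1.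
  by rewrite ab mulrC /S -[1 - b]opprB mulNr -subrX1 opprB.
rewrite (@fps_eqmodM n.+1 l (S n.+1) a a)// Sa fps_coefB fps_eqmodX0//.
by rewrite subr0.
Qed.

Lemma fps_eqmodXz i r :
  fps_eqmod i ((1 - 'q^i : fps R) ^ r) 1.
Proof.
case: i => [//|i]; set x := 1 - _.
have x1 : fps_eqmod i.+1 x 1.
  by move=> k ki; rewrite /x fps_coefB/= (ltn_eqF ki) subr0.
have xn n : fps_eqmod i.+1 (x ^+ n) 1.
  elim: n => [|n IH]; first by rewrite expr0.
  by rewrite exprS -[1 in X in fps_eqmod _ _ X]mulr1; apply: fps_eqmodM.
have ux n : x ^+ n \is a GRing.unit by apply: fps_unit1; rewrite xn.
case: r => n; first exact: xn.
rewrite NegzE -exprnN -(mulVr (ux n.+1)) => k ki.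
rewrite -[in LHS](mulr1 (x ^- n.+1)); apply: (@fps_eqmodM i.+1) => // l li.
by rewrite xn.
Qed.

End Theory.

Definition p_ (r : int) (n : nat) : int :=
  prod_ge1 (fun i => (1 - 'q^i) ^ r) n.

Definition E (j : nat) : fps int := prod_ge1 (fun n => 1 - 'q^(j * n)).

Lemma p_cvg r :
  fps_cvg (fun N => \prod_(1 <= i < N) (1 - 'q^i) ^ r) (FPS (p_ r)).
Proof.
rewrite (_ : FPS _ = prod_ge1 (fun i => (1 - 'q^i) ^ r)); last exact/fpsP.
by apply: prod_ge1_cvg => i; apply: fps_eqmodXz.
Qed.

Lemma E_cvg j : (0 < j)%N ->
  fps_cvg (fun N => \prod_(1 <= n < N) (1 - 'q^(j * n))) (E j).
Proof.
move=> j0; apply: prod_ge1_cvg => i k ki; rewrite fps_coefB/=.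
by rewrite (@ltn_eqF k (j * i)%N) ?subr0// (leq_trans ki)// leq_pmull.
Qed.

Lemma E_unit j : (0 < j)%N -> E j \is a GRing.unit.
Proof.
move=> j0; apply: fps_unit1; have [N /(_ N (leqnn _)) <-] := E_cvg j0 0%N.
rewrite big_nat_cond; elim/big_ind: _ => // [x y x1 y1|i].
  by rewrite fps_coefM big_ord_recl big_ord0 addr0 x1 y1 mulr1.
rewrite andbT => /andP[i0 _]; rewrite fps_coefB/= (@ltn_eqF 0 (j * i)%N) ?subr0//.
by rewrite muln_gt0 j0.
Qed.

(** Since [i - s] is truncated at [0], the clause [m 0 _ = 0] covers all
    indices [i' <= 0] of the recurrence; the column [j = 0] is a dummy. *)
Fixpoint m (i j : nat) {struct j} : int :=
  if i == 0%N then 0 else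
  match j with
  | 0 => 0
  | 1 => match i with
         | 1 => 5
         | 2 => 10
         | 3 => 9
         | 4 => 4
         | 5 => 1
         | _ => 0
         end
  | j'.+1 =>
      25 * m (i - 1) j' + 25 * m (i - 2) j' + 15 * m (i - 3) j'
      + 5 * m (i - 4) j' + m (i - 5) j'
  end.

(** The sum over [i >= 1] is a finitely supported one, see [cS]; the row
    [j = 0] is a dummy. *)
Fixpoint c (j k : nat) {struct j} : int :=
  match j with
  | 0 => 0
  | 1 => match k with
         | 1 => 140
         | 2 => 49 * 5 ^+ 4
         | 3 => 21 * 5 ^+ 7
         | 4 => 91 * 5 ^+ 8
         | 5 => 7 * 5 ^+ 11
         | 6 => 5 ^+ 13
         | _ => 0
         end
  | j'.+1 =>
      if odd j'
      then \sum_(i \in [set i | (1 <= i)%N]) c j' i * m (6 * i + 6) (i + k + 1)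
      else \sum_(i \in [set i | (1 <= i)%N]) c j' i * m (6 * i + 7) (i + k + 1)
  end.

Lemma m_eq0 i j : (5 * j < i)%N -> m i j = 0.
Proof.
elim: j i => [|[|j] IH] i; first by case: i.
  by case: i => [|[|[|[|[|[|i]]]]]].
case: i => // i ij; have H s : (s <= 5)%N -> m (i.+1 - s) j.+1 = 0.
  by move=> s5; apply: IH; lia.
transitivity (25 * m (i.+1 - 1) j.+1 + 25 * m (i.+1 - 2) j.+1
  + 15 * m (i.+1 - 3) j.+1 + 5 * m (i.+1 - 4) j.+1 + m (i.+1 - 5) j.+1) => //.
by rewrite !H.
Qed.

Lemma cS j k : (0 < j)%N ->
  c j.+1 k = \sum_(1 <= i < 5 * k)
    c j i * m (6 * i + (if odd j then 6 else 7)) (i + k + 1).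
Proof.
case: j => // j _.
pose F i := c j.+1 i * m (6 * i + (if odd j.+1 then 6 else 7)) (i + k + 1).
transitivity (\sum_(i \in [set i | (1 <= i)%N]) F i).
  by rewrite /F /=; case: ifP.
rewrite [RHS]fsbig_seq ?iota_uniq//; apply/esym; apply: fsbig_widen => i /=.
  by rewrite mem_index_iota => /andP[].
rewrite mem_index_iota => -[i1 ik]; rewrite /F m_eq0 ?mulr0//.
by case: ifP => _; lia.
Qed.

Lemma mod24_5 j : (5 ^ (2 * j) %% 24 = 1)%N.
Proof. by rewrite expnM -modnXm (_ : 5 ^ 2 %% 24 = 1)%N// exp1n. Qed.

Lemma dvd24_odd j : (0 < j)%N -> (24 %| 13 * 5 ^ (2 * j - 1) + 7)%N.
Proof.
case: j => // j _; rewrite (_ : 2 * j.+1 - 1 = (2 * j).+1)%N; last by lia.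
by rewrite expnS mulnA /dvdn -modnDml -modnMmr mod24_5.
Qed.

Lemma dvd24_even j : (24 %| 17 * 5 ^ (2 * j) + 7)%N.
Proof. by rewrite /dvdn -modnDml -modnMmr mod24_5. Qed.

(* Main.v *)
From HB Require Import structures.
Require Import Defs.
From mathcomp Require Import all_boot all_order all_algebra.
From mathcomp Require Import algC cyclotomic.
From mathcomp Require Import zify ring.

Set Implicit Arguments.
Unset Strict Implicit.
Unset Printing Implicit Defensive.

Import GRing.Theory.

Local Open Scope ring_scope.

(** Write [e = E_1], [f = E_25], [x = q f / e].  The pentagonal number theorem
    gives the 5-dissection [e = A - q f - q^2 C] with [A], [C] series in [q^5], and
    Jacobi's expansion of [e^3], which has no exponent congruent to [2] modulo [5],
    forces [A C = f^2].  The product of [e(z q)] over the fifth roots of unity [z]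
    equals [E_5^6 / f]; in terms of [A], [f], [C] it becomes the equation
    [x^5 = y (1 + 5 x + 15 x^2 + 25 x^3 + 25 x^4)], where [y = q^5 E_25^6 / E_5^6] is
    a series in [q^5].  Hence the parts of the powers [x^i] supported on multiples of
    [5] satisfy the recurrence of the [m i j]: they are [\sum_j m i j * y^j].  Since
    [q^(5 l + 5)] times each term at one level is a series in [q^5] times a power of [x]
    (up to a shift of [q]), extracting a progression modulo [5] gives the next level. *)

(** * Congruences of power series *)

Section EqMod.
Variable R : comNzRingType.
Implicit Types a b c d : fps R.

Lemma fps_eqmod_sym n a b : fps_eqmod n a b -> fps_eqmod n b a.
Proof. by move=> ab k kn; rewrite ab. Qed.

Lemma fps_eqmod_trans n b a c :
  fps_eqmod n a b -> fps_eqmod n b c -> fps_eqmod n a c.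
Proof. by move=> ab bc k kn; rewrite ab// bc. Qed.

Lemma fps_eqmod_leq n k a b : (k <= n)%N -> fps_eqmod n a b -> fps_eqmod k a b.
Proof. by move=> kn ab i ik; apply: ab; apply: leq_trans kn. Qed.

Lemma fps_eqmodD n a b c d :
  fps_eqmod n a b -> fps_eqmod n c d -> fps_eqmod n (a + c) (b + d).
Proof. by move=> ab cd k kn; rewrite !fps_coefD ab// cd. Qed.

Lemma fps_eqmod_sum n (I : Type) (r : seq I) (P : pred I) (F G : I -> fps R) :
  (forall i, P i -> fps_eqmod n (F i) (G i)) ->
  fps_eqmod n (\sum_(i <- r | P i) F i) (\sum_(i <- r | P i) G i).
Proof.
move=> FG; elim/big_ind2: _ => // a b c d; exact: fps_eqmodD.
Qed.

Lemma fps_eqmod_prod n (I : Type) (r : seq I) (P : pred I) (F G : I -> fps R) :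
  (forall i, P i -> fps_eqmod n (F i) (G i)) ->
  fps_eqmod n (\prod_(i <- r | P i) F i) (\prod_(i <- r | P i) G i).
Proof.
move=> FG; elim/big_ind2: _ => // a b c d; exact: fps_eqmodM.
Qed.

Lemma fps_eqmodX n k a b : fps_eqmod n a b -> fps_eqmod n (a ^+ k) (b ^+ k).
Proof.
by move=> ab; elim: k => // k IH; rewrite !exprS; apply: fps_eqmodM.
Qed.

Lemma fps_eqmod_eq a b : (forall n, fps_eqmod n a b) -> a = b.
Proof. by move=> ab; apply/fpsP => n; apply: (ab n.+1). Qed.

Lemma fps_coef_sum n (I : Type) (r : seq I) (P : pred I) (F : I -> fps R) :
  (\sum_(i <- r | P i) F i) n = \sum_(i <- r | P i) F i n.
Proof. by elim/big_rec2: _ => // i x y _ <-. Qed.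

Lemma fps_coefN a n : (- a) n = - a n.
Proof. by []. Qed.

Lemma fps_coef_intr (z : int) a n : (z%:~R * a) n = z%:~R * a n.
Proof.
rewrite !mulrzl; case: z => k.
  by rewrite -!pmulrn; elim: k => // k IH; rewrite !mulrS fps_coefD IH.
rewrite !NegzE !mulrNz fps_coefN -!pmulrn; congr (- _).
by elim: k.+1 => // i IH; rewrite !mulrS fps_coefD IH.
Qed.

Lemma fps_coefMq k a n :
  ('q^k * a) n = if (n < k)%N then 0 else a (n - k)%N.
Proof.
case: ltnP => [|kn]; first exact: fps_eqmodMq.
rewrite fps_coefM (bigD1 (Ordinal (kn : k < n.+1)%N))//= eqxx mul1r.
rewrite big1 ?addr0// => i /eqP ik /=.
case: eqP => [e|]; last by rewrite mul0r.
by case: ik; apply: val_inj.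
Qed.

Lemma fps_mulqI k : injective (fun a => 'q^k * a).
Proof.
move=> a b /fpsP ab; apply/fpsP => n; move: (ab (n + k)%N).
by rewrite !fps_coefMq ltnNge leq_addl/= addnK.
Qed.

Lemma fps_q0 : 'q^0 = 1 :> fps R.
Proof. exact/fpsP. Qed.

Lemma fps_qD i j : 'q^(i + j) = 'q^i * 'q^j :> fps R.
Proof.
apply/fpsP => n; rewrite fps_coefMq/=; case: ltnP => ni.
  by rewrite ltn_eqF// (leq_trans ni)// leq_addr.
by congr (_%:R); apply/eqP/eqP; lia.
Qed.

Lemma fps_qX i k : 'q^i ^+ k = 'q^(i * k) :> fps R.
Proof.
elim: k => [|k IH]; first by rewrite muln0 expr0 fps_q0.
by rewrite exprS IH -fps_qD mulnS.
Qed.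

Lemma fps_eqmodMql k n a b :
  fps_eqmod n a b -> fps_eqmod (n + k) ('q^k * a) ('q^k * b).
Proof.
move=> ab i ink; rewrite !fps_coefMq; case: ltnP => // ki.
by apply: ab; lia.
Qed.

End EqMod.

(** * Sections of a series modulo 5 *)

Section Dissection.
Variable R : comNzRingType.
Implicit Types a b c d : fps R.

(** [dil a] is a(q^5) and [sect 0] is the operator U_5; for r < 5, ['q^r * dil (sect r a)] is the
    part of [a] on exponents congruent to r modulo 5. *)
Definition sect r a : fps R := FPS (fun n => a (5 * n + r)%N).
Definition dil a : fps R := FPS (fun n => if (5 %| n)%N then a (n %/ 5)%N else 0).

Lemma sum_dvd5 (F : nat -> R) n r : (r < 5)%N ->
  (forall i, ~~ (5 %| i)%N -> F i = 0) ->
  \sum_(i < (5 * n + r).+1) F i = \sum_(j < n.+1) F (5 * j)%N.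
Proof.
move=> r5 F0; rewrite -(big_mkord xpredT F).
transitivity (\sum_(0 <= i < 5 * n.+1) F i).
  rewrite [RHS](big_cat_nat (n := (5 * n + r).+1))//=; last by lia.
  rewrite [X in _ + X]big_nat [X in _ + X]big1 ?addr0// => i.
  by move=> h; apply: F0; move: h; lia.
elim: n => [|n IH]; last first.
  have -> : (5 * n.+2 = (5 * n.+1).+4.+1)%N by lia.
  rewrite 5?big_nat_recr//= IH [RHS]big_ord_recr/=.
  rewrite (F0 (_ * _).+1) ?(F0 _.+2) ?(F0 _.+3) ?(F0 _.+4) ?addr0//; lia.
rewrite big_ord_recl big_ord0 muln1 !big_nat_recr//= big_geq// add0r.
by rewrite (F0 1%N) ?(F0 2%N) ?(F0 3%N) ?(F0 4%N) ?addr0 ?addr0.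
Qed.

(** Only multiples of 5 in the convolution meet the support of [dil a]. Thus sections are linear
    over series in q^5, the property behind every later extraction. *)
Lemma sect_dilM r a b : (r < 5)%N -> sect r (dil a * b) = a * sect r b.
Proof.
move=> r5; apply/fpsP => n; rewrite [LHS]/= fps_coefM.
rewrite (sum_dvd5 (F := fun i => dil a i * b (5 * n + r - i)%N))//; last first.
  by move=> i /negbTE h; rewrite /= h mul0r.
apply: eq_bigr => i _; rewrite /= dvdn_mulr// mulKn//; congr (_ * b _).
by have := ltn_ord i; lia.
Qed.

Lemma sectP a b : (forall r, (r < 5)%N -> sect r a = sect r b) <-> a = b.
Proof.
split=> [ab|->//]; apply/fpsP => n.
have /fpsP /(_ (n %/ 5)%N) /= := ab (n %% 5)%N (ltn_pmod n (isT : 0 < 5)%N).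
by rewrite mulnC -divn_eq.
Qed.

Lemma sect_dil r a : (r < 5)%N -> sect r (dil a) = if r == 0%N then a else 0.
Proof.
move=> r5; apply/fpsP => n /=; rewrite dvdn_addr ?dvdn_mulr//.
case: r r5 => [|r] r5 /=; first by rewrite addn0 mulKn.
by rewrite gtnNdvd.
Qed.

Lemma sectD r a b : sect r (a + b) = sect r a + sect r b.
Proof. exact/fpsP. Qed.

Lemma sectN r a : sect r (- a) = - sect r a.
Proof. exact/fpsP. Qed.

Lemma sect_intr r (z : int) a : sect r (z%:~R * a) = z%:~R * sect r a.
Proof. by apply/fpsP => n; rewrite fps_coef_intr; apply: fps_coef_intr. Qed.

Lemma sect_sum r (I : Type) (s : seq I) (P : pred I) (F : I -> fps R) :
  sect r (\sum_(i <- s | P i) F i) = \sum_(i <- s | P i) sect r (F i).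
Proof. by apply/fpsP => n; rewrite fps_coef_sum; apply: fps_coef_sum. Qed.

Lemma sect_q r k : (r < 5)%N ->
  sect r 'q^k = if (k %% 5 == r)%N then 'q^(k %/ 5) else 0.
Proof.
move=> r5; apply/fpsP => n; case: ifP => /= kr.
  by congr (nat_of_bool _)%:R; apply/eqP/eqP; lia.
by case: eqP => // e; move: kr; rewrite -e; lia.
Qed.

Lemma sect_qdil r k a : (r < 5)%N ->
  sect r ('q^k * dil a) = if (k %% 5 == r)%N then 'q^(k %/ 5) * a else 0.
Proof.
move=> r5; rewrite mulrC sect_dilM// sect_q//.
by case: ifP; rewrite ?mulr0// mulrC.
Qed.

Lemma dilM a b : dil (a * b) = dil a * dil b.
Proof.
apply/sectP => r r5; rewrite sect_dilM// !sect_dil//.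
by case: ifP; rewrite ?mulr0.
Qed.

Lemma dilD a b : dil (a + b) = dil a + dil b.
Proof. by apply/fpsP => n /=; case: ifP; rewrite ?addr0. Qed.

Lemma dilN a : dil (- a) = - dil a.
Proof. by apply/fpsP => n /=; case: ifP; rewrite ?oppr0. Qed.

Lemma dil_q k : dil 'q^k = 'q^(5 * k).
Proof.
apply/sectP => r r5; rewrite sect_dil// sect_q// mulKn//.
by rewrite modnMr eq_sym.
Qed.

Lemma dil1 : dil 1 = 1.
Proof. by rewrite -fps_q0 dil_q. Qed.

Lemma dilX a k : dil (a ^+ k) = dil a ^+ k.
Proof. by elim: k => [|k IH]; rewrite ?expr0 ?dil1// !exprS dilM IH. Qed.

Lemma dil_prod (I : Type) (s : seq I) (P : pred I) (F : I -> fps R) :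
  dil (\prod_(i <- s | P i) F i) = \prod_(i <- s | P i) dil (F i).
Proof. exact: (big_morph _ dilM dil1). Qed.

Lemma dilV a : a \is a GRing.unit -> dil a^-1 = (dil a)^-1.
Proof.
move=> ua; have h : dil a^-1 * dil a = 1 by rewrite -dilM mulVr ?dil1.
have u : dil a \is a GRing.unit.
  by apply/unitrP; exists (dil a^-1); rewrite h mulrC h.
by apply: (mulIr u); rewrite h mulVr.
Qed.

Lemma dil_dissection a : a = \sum_(r < 5) 'q^r * dil (sect r a).
Proof.
apply/sectP => r r5; rewrite sect_sum.
rewrite (bigD1 (Ordinal r5))//= big1 => [|i ir].
  by rewrite sect_qdil// modn_small// eqxx divn_small// fps_q0 mul1r addr0.
rewrite sect_qdil// modn_small//; case: eqP => // e.
by case/eqP: ir; apply: val_inj.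
Qed.

End Dissection.

(** * Finite truncations of the Euler products *)

Definition qpoch n : fps int := \prod_(1 <= i < n.+1) (1 - 'q^i).

(** Factors of index at least N are 1 modulo q^n, so they can be stripped one by one from a product
    long enough for the coefficient to be final. *)
Lemma E_eqmod j n N : (0 < j)%N -> (n <= N)%N ->
  fps_eqmod n (E j) (\prod_(1 <= i < N) (1 - 'q^(j * i))).
Proof.
move=> j0 nN k kn; have [N0 h] := E_cvg j0 k.
rewrite -(h (N0 + N)%N) ?leq_addr//; elim: N0 {h} => // d IH.
rewrite addSn big_nat_recr; last by lia.
rewrite -[RHS]IH -[X in _ = fps_coef X _]mulr1.
apply: (@fps_eqmodM _ n) => // i ik; rewrite fps_coefB/=.
by rewrite (@ltn_eqF i (j * _)%N) ?subr0//; nia.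
Qed.

Lemma qpoch_eqmod n N : (n <= N.+1)%N -> fps_eqmod n (E 1) (qpoch N).
Proof.
move=> nN; rewrite /qpoch; apply: (fps_eqmod_trans (E_eqmod (j := 1) _ nN)) => //.
by under eq_bigr do rewrite mul1n.
Qed.

Lemma dil_E j : (0 < j)%N -> dil (E j) = E (5 * j).
Proof.
move=> j0; apply/fpsP => n.
rewrite (@E_eqmod (5 * j) n.+1 n.+1)//; last by rewrite muln_gt0.
under eq_bigr do rewrite -mulnA -dil_q -dil1 -dilN -dilD.
rewrite -dil_prod/=; case: ifP => // _; apply: (@E_eqmod j n.+1 n.+1) => //.
by rewrite ltnS leq_div.
Qed.

Lemma E_coef0 j : (0 < j)%N -> E j 0%N = 1.
Proof. by move=> j0; rewrite (@E_eqmod j 1 1)// big_geq. Qed.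

(** * The pentagonal number theorem *)

Definition qpoch_from s n : fps int := \prod_(s.+1 <= i < n.+1) (1 - 'q^i).

Definition shanks n : fps int :=
  \sum_(s < n.+1) (-1) ^+ s * qpoch_from s n * 'q^(s * n + 'C(s.+1, 2)).

(** The exponents are s(3s-1)/2 and s(3s+1)/2, the generalised pentagonal numbers. *)
Definition pentagonal_term s : fps int :=
  (-1) ^+ s * ('q^(s * s + 'C(s, 2)) + 'q^(s * s + 'C(s.+1, 2))).

Definition pentagonal n : fps int := 1 + \sum_(s < n) pentagonal_term s.+1.

Lemma binS2 n : ('C(n.+1, 2) = 'C(n, 2) + n)%N.
Proof. by rewrite binS bin1. Qed.

(** Shanks' telescoping: with [a] and [b] as in the proof, [a s * (1 - q^s) = - b (s - 1)]. *)
Lemma shanksS n : shanks n.+1 = shanks n + pentagonal_term n.+1.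
Proof.
pose b s : fps int := (-1) ^+ s * qpoch_from s n * 'q^(s.+1 * n.+1 + 'C(s.+1, 2)).
pose a s : fps int := (-1) ^+ s * qpoch_from s n * 'q^(s * n + 'C(s.+1, 2)).
have ab k : (k <= n)%N -> \sum_(s < k.+1) (a s * (1 - 'q^s) + b s) = b k.
  elim: k => [|k IH] kn; first by rewrite big_ord_recr big_ord0/= fps_q0 subrr mulr0 !add0r.
  rewrite big_ord_recr IH ?(ltnW kn)//= /a /b.
  rewrite [qpoch_from k n]big_ltn// -/(qpoch_from k.+1 n) exprS.
  have -> : (k.+1 * n + 'C(k.+2, 2) = k.+1 * n.+1 + 'C(k.+1, 2))%N.
    by rewrite (binS2 k.+1); lia.
  ring.
rewrite /pentagonal_term /shanks big_ord_recr/=.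
have -> : qpoch_from n.+1 n.+1 = 1 by rewrite /qpoch_from big_geq.
suff -> : \sum_(i < n.+1) (-1) ^+ i * qpoch_from i n.+1 * 'q^(i * n.+1 + 'C(i.+1, 2))
    = \sum_(i < n.+1) a i - b n.
  by rewrite /b [qpoch_from n n]big_geq// !exprS; ring.
rewrite -(ab n (leqnn n)) -sumrB; apply: eq_bigr => -[s /= sn] _.
rewrite /a /b [qpoch_from s n.+1]big_nat_recr//= -/(qpoch_from s n).
have -> : (s * n.+1 + 'C(s.+1, 2) = s + (s * n + 'C(s.+1, 2)))%N by lia.
have -> : (s.+1 * n.+1 + 'C(s.+1, 2) = n.+1 + (s + (s * n + 'C(s.+1, 2))))%N by lia.
by rewrite !fps_qD; ring.
Qed.

Lemma shanksE n : shanks n = pentagonal n.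
Proof.
rewrite /pentagonal; elim: n => [|n IH].
  by rewrite /shanks big_ord_recr !big_ord0/= /qpoch_from big_geq// fps_q0 !mulr1 add0r addr0.
by rewrite shanksS IH big_ord_recr/= addrA.
Qed.

(** The term s = 0 of [shanks n] is [qpoch n]; the terms with s > 0 carry an exponent s n + s(s+1)/2
    > n and are invisible at this precision. *)
Lemma E1_pentagonal n : fps_eqmod n.+1 (E 1) (pentagonal n).
Proof.
apply: (fps_eqmod_trans (qpoch_eqmod (leqnn _))).
rewrite -shanksE /shanks big_ord_recl/= fps_q0 mulr1 mul1r.
rewrite -[X in fps_eqmod _ X](addr0 (qpoch n)); apply: fps_eqmodD => //.
move=> k kn; rewrite fps_coef_sum big1// => i _; rewrite mulrC.
apply: fps_eqmodMq; apply: leq_trans kn _.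
by rewrite /bump/= add1n binS2; lia.
Qed.

(** * Jacobi's identity for the cube of the Euler product *)

Section GaussBinomial.
Variable R : comNzRingType.
Implicit Types Q x y : R.

(** Gaussian binomials through the q-Pascal rule: without division, the base may be any ring
    element, in particular a constant polynomial over power series. *)
Fixpoint gauss Q N k : R :=
  match N, k with
  | _, 0 => 1
  | 0, _.+1 => 0
  | N'.+1, k'.+1 => Q ^+ k * gauss Q N' k + gauss Q N' k'
  end.

Arguments gauss : simpl never.

Lemma gauss_n0 Q N : gauss Q N 0 = 1. Proof. by case: N. Qed.

Lemma gaussS Q N k :
  gauss Q N.+1 k.+1 = Q ^+ k.+1 * gauss Q N k.+1 + gauss Q N k.
Proof. by []. Qed.

Lemma gauss_small Q N k : (N < k)%N -> gauss Q N k = 0.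
Proof.
elim: N k => [|N IH] [|k]// Nk; rewrite gaussS !IH ?mulr0 ?addr0//.
exact: ltnW.
Qed.

(** The q-binomial theorem, homogenised. Splitting off the factor i = 0 replaces x by x Q in the
    rest, which amounts to the q-Pascal rule on coefficients. *)
Lemma gauss_product Q x y N : \prod_(i < N) (y - x * Q ^+ i) =
  \sum_(k < N.+1) (-1) ^+ k * Q ^+ 'C(k, 2) * gauss Q N k * x ^+ k * y ^+ (N - k).
Proof.
elim: N x => [|N IH] x.
  by rewrite big_ord0 big_ord_recl big_ord0 /= !mulr1 addr0.
rewrite big_ord_recl/= expr0 mulr1.
under eq_bigr => i _ do rewrite /bump/= add1n exprS mulrA.
rewrite {}IH mulrBl.
rewrite [in RHS]big_ord_recl/= ?gauss_n0 ?expr0 ?subn0 ?mulr1 ?mul1r.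
under [in RHS]eq_bigr => i _ do rewrite /bump/= add1n gaussS mulrDr !mulrDl.
rewrite big_split/= addrA; congr (_ + _).
  rewrite [in RHS]big_ord_recr/= (@gauss_small Q N N.+1)// mulr0 mulr0 !mul0r addr0.
  rewrite big_ord_recl/= ?gauss_n0 ?expr0 ?subn0 ?mulr1 ?mul1r mulrDr -exprS.
  congr (_ + _); rewrite mulr_sumr; apply: eq_bigr => i _.
  rewrite /bump/= add1n exprMn (_ : N.+1 - i.+1 = (N - i.+1).+1)%N.
    by rewrite [y ^+ _.+1]exprS; ring.
  by have := ltn_ord i; lia.
rewrite mulr_sumr -sumrN; apply: eq_bigr => i _.
by rewrite subSS exprMn binS2 exprD !exprS; ring.
Qed.
End GaussBinomial.
Arguments gauss : simpl never.

Lemma gauss_polyC (R : comNzRingType) (Q : R) N k :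
  gauss (Q%:P : {poly R}) N k = (gauss Q N k)%:P.
Proof.
elim: N k => [|N IH] [|k] //; rewrite !gaussS.
by rewrite !IH polyCD polyCM -polyC_exp.
Qed.

Local Notation qbin := (gauss ('q^1 : fps int)).

Lemma qpochS n : qpoch n.+1 = qpoch n * (1 - 'q^n.+1).
Proof. by rewrite /qpoch big_nat_recr. Qed.

Lemma qpoch0 : qpoch 0 = 1.
Proof. by rewrite /qpoch big_geq. Qed.

Lemma qpoch_unit n : qpoch n \is a GRing.unit.
Proof.
by apply: fps_unit1; rewrite -(@qpoch_eqmod 1 n) ?E_coef0.
Qed.

(** The induction rests on 1 - q^(N+1) = q^(k+1) (1 - q^(N-k)) + (1 - q^(k+1)). *)
Lemma qbin_qpoch N k : (k <= N)%N -> qbin N k * qpoch k * qpoch (N - k) = qpoch N.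
Proof.
elim: N k => [|N IH] [|k] //.
- by rewrite /= qpoch0 !mul1r.
- by rewrite gauss_n0 qpoch0 !mul1r subn0.
rewrite ltnS leq_eqVlt => /orP[/eqP->|kN].
  rewrite gaussS gauss_small// mulr0 add0r subSS subnn qpoch0 mulr1.
  have := IH N (leqnn _); rewrite subnn qpoch0 mulr1 !qpochS => {2}<-; ring.
have e1 := IH k.+1 kN; have e2 := IH k (ltnW kN).
rewrite gaussS subSS -(subnSK kN) !qpochS subnSK// fps_qX mul1n.
move: e2; rewrite -(subnSK kN) qpochS subnSK// => e2.
have eN : 'q^N.+1 = 'q^k.+1 * 'q^(N - k) :> fps int by rewrite -fps_qD; congr fpsXn; lia.
transitivity ('q^k.+1 * (1 - 'q^(N - k)) * (qbin N k.+1 * qpoch k.+1 * qpoch (N - k.+1))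
  + (1 - 'q^k.+1) * (qbin N k * qpoch k * (qpoch (N - k.+1) * (1 - 'q^(N - k))))).
  by rewrite qpochS; ring.
by rewrite e1 e2 eN; ring.
Qed.

Lemma qbin_sym N k : (k <= N)%N -> qbin N (N - k) = qbin N k.
Proof.
move=> kN; apply: (mulIr (qpoch_unit k)); apply: (mulIr (qpoch_unit (N - k))).
by rewrite qbin_qpoch// mulrAC -[k in X in _ * X](subKn kN) qbin_qpoch// leq_subr.
Qed.

Lemma prod_qsub n : \prod_(i < n) ('q^n - 'q^i) = (-1) ^+ n * 'q^('C(n, 2)) * qpoch n.
Proof.
transitivity (\prod_(i < n) (-1 * 'q^i * (1 - 'q^(n - i))) : fps int).
  apply: eq_bigr => i _; have : 'q^n = 'q^i * 'q^(n - i) :> fps int.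
    by rewrite -fps_qD; congr fpsXn; have := ltn_ord i; lia.
  by move->; ring.
rewrite !big_split/= prodr_const card_ord; congr (_ * _ * _).
  elim: n => [|n IH]; first by rewrite big_ord0 fps_q0.
  by rewrite big_ord_recr IH/= -fps_qD binS2.
rewrite /qpoch big_add1 big_mkord (reindex_inj rev_ord_inj)/=.
by apply: eq_bigr => i _; rewrite subKn.
Qed.

Lemma prod_qsub_shift n :
  \prod_(n.+1 <= i < (n + n).+1) ('q^n - 'q^i) = 'q^(n * n) * qpoch n.
Proof.
rewrite -[n.+1]add1n big_addn -addSn addnK.
transitivity (\prod_(1 <= i < n.+1) ('q^n * (1 - 'q^i)) : fps int).
  by apply: eq_bigr => i _; rewrite addnC fps_qD; ring.
by rewrite big_split/= prodr_const_nat subn1 fps_qX.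
Qed.

Lemma binD2 a b : ('C(a + b, 2) = 'C(a, 2) + 'C(b, 2) + a * b)%N.
Proof. by elim: a => [|a IH]; [rewrite add0n bin0n | rewrite addSn !binS2 IH]; lia. Qed.

Lemma sqr_bin2 j : (j * j = 'C(j, 2) + 'C(j, 2) + j)%N.
Proof. by elim: j => // j IH; rewrite binS2; lia. Qed.

(** The derivative at [X = 1] of the q-binomial theorem for
    [\prod_(i < 2 n + 1) (q^n X - q^i)], a product that vanishes there. *)
Lemma deriv_jacobi_product n :
  'q^n * ((-1) ^+ n * 'q^('C(n, 2)) * qpoch n * ('q^(n * n) * qpoch n)) =
  \sum_(k < (n + n).+2) (-1) ^+ k * 'q^('C(k, 2) + n * ((n + n).+1 - k))
     * qbin (n + n).+1 k *+ ((n + n).+1 - k).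
Proof.
have := gauss_product ('q^1)%:P 1 (('q^n)%:P * 'X : {poly fps int}) (n + n).+1.
move/(congr1 (fun p => p^`().[1])) => h; etransitivity; last first.
  etransitivity; first exact: h.
  rewrite linear_sum horner_sum; apply: eq_bigr => k _ /=.
  rewrite gauss_polyC expr1n mulr1 -polyC_exp exprMn -polyC_exp mulrA.
  rewrite -(rmorph_sign polyC) -!polyCM mul_polyC derivZ hornerZ derivXn hornerMn hornerXn.
  rewrite expr1n !fps_qX mul1n fps_qD -[in RHS]mulr_natr -mulr_natr.
  by ring.
rewrite -(big_mkord xpredT (fun i => ('q^n)%:P * 'X - 1 * (('q^1)%:P ^+ i) : {poly fps int})).
(* The factor i = n is q^n (X - 1), so at X = 1 the derivative leaves q^n times the product of the
   other factors. *)
rewrite (big_cat_nat (n := n))//=; last by lia.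
rewrite [X in (_ * X)^`()]big_ltn; last by lia.
rewrite mul1r -polyC_exp fps_qX mul1n [X in X^`()]mulrCA.
have -> : ('q^n)%:P * 'X - ('q^n)%:P = ('q^n)%:P * ('X - 1) :> {poly fps int} by ring.
rewrite -[X in X^`()]mulrA [X in X^`()]mul_polyC derivZ hornerZ derivM hornerD !hornerM derivXsubC.
have -> : ('X - 1 : {poly fps int}).[1] = 0 by rewrite !hornerE subrr.
have -> : (1 : {poly fps int}).[1] = 1 by rewrite hornerE.
rewrite mul0r addr0 mul1r !horner_prod.
rewrite -prod_qsub -prod_qsub_shift big_mkord.
by congr (_ * (_ * _)); apply: eq_bigr => i _;
  rewrite mul1r -polyC_exp fps_qX mul1n !hornerE.
Qed.

Lemma signrB n j : (j <= n)%N -> (-1) ^+ (n - j) = (-1) ^+ n * (-1) ^+ j :> fps int.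
Proof. by move=> jn; rewrite -signr_odd oddB// signr_addb !signr_odd. Qed.

(** Cancels the power of [q] in [deriv_jacobi_product] and pairs the indices [n - j]
    and [n + 1 + j]. *)
Lemma qpoch_sqr n : qpoch n ^+ 2 =
  \sum_(j < n.+1) (-1) ^+ j * (j + j + 1)%:R * 'q^('C(j.+1, 2)) * qbin (n + n).+1 (n - j).
Proof.
pose M := (n + 'C(n, 2) + n * n)%N.
apply: (@fps_mulqI _ M); rewrite /=; apply: (can_inj (signrMK n)).
have -> : (-1) ^+ n * ('q^M * qpoch n ^+ 2) =
   'q^n * ((-1) ^+ n * 'q^('C(n, 2)) * qpoch n * ('q^(n * n) * qpoch n)).
  by rewrite /M !fps_qD; ring.
rewrite deriv_jacobi_product -(big_mkord xpredT (fun k => (-1) ^+ k *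
  'q^('C(k, 2) + n * ((n + n).+1 - k)) * qbin (n + n).+1 k *+ ((n + n).+1 - k))).
rewrite (big_cat_nat (n := n.+1))//=; last by lia.
rewrite [X in X + _]big_mkord (reindex_inj rev_ord_inj)/=.
rewrite -[X in \sum_(X <= _ < _) _]add0n big_addn (_ : (n + n).+2 - n.+1 = n.+1)%N; last by lia.
rewrite big_mkord -big_split/= !mulr_sumr; apply: eq_bigr => -[j /= jn] _.
rewrite ltnS in jn; rewrite subSS.
have -> : qbin (n + n).+1 (j + n.+1) = qbin (n + n).+1 (n - j).
  by rewrite -qbin_sym; [congr gauss; lia|lia].
have e1 : ('C(n - j, 2) + n * ((n + n).+1 - (n - j)) = M + 'C(j.+1, 2))%N.
  have := sqr_bin2 j; have := binD2 (n - j) j; rewrite subnK// /M binS2.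
  nia.
have e2 : ('C(j + n.+1, 2) + n * ((n + n).+1 - (j + n.+1)) = M + 'C(j.+1, 2))%N.
  have := sqr_bin2 j; have := binD2 j n.+1; rewrite /M !binS2.
  nia.
rewrite e1 e2 fps_qD signrB// exprD exprS.
(* The paired terms have opposite signs, and their multiplicities differ by 2j + 1. *)
have -> : ((n + n).+1 - (n - j) = (n - j) + (j + j + 1))%N by lia.
have -> : ((n + n).+1 - (j + n.+1) = n - j)%N by lia.
rewrite mulrnDr -![(_ * _) *+ _]mulr_natr.
move: (qbin _ _) 'q^M 'q^('C(j.+1, 2)) ((-1) ^+ n) ((-1) ^+ j) (n - j)%:R (j + j + 1)%:R.
by move=> g x y u v a b; ring.
Qed.

(** At this precision the three finite products in [qbin_qpoch] all agree with E_1, and one of the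
    E_1 cancels. *)
Lemma qbin_eqmod N k n : (n <= k.+1)%N -> (n <= (N - k).+1)%N -> (k <= N)%N ->
  fps_eqmod n (qbin N k * E 1) 1.
Proof.
move=> nk nNk kN; have h : fps_eqmod n (qbin N k * E 1 * E 1) (E 1).
  apply: (@fps_eqmod_trans _ _ (qbin N k * qpoch k * qpoch (N - k))).
    by apply: fps_eqmodM; [apply: fps_eqmodM => //|]; apply: qpoch_eqmod.
  by rewrite qbin_qpoch//; apply/fps_eqmod_sym/qpoch_eqmod; lia.
have uE := E_unit (j := 1) isT.
rewrite -[X in fps_eqmod _ X](mulrK uE) -[X in fps_eqmod _ _ X](mulrV uE).
exact: fps_eqmodM.
Qed.

Definition jacobi n : fps int :=
  \sum_(j < n.+1) (-1) ^+ j * (j + j + 1)%:R * 'q^('C(j.+1, 2)).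

Lemma E1_cube n : fps_eqmod n.+1 (E 1 ^+ 3) (jacobi n).
Proof.
apply: (@fps_eqmod_trans _ _ (qpoch n ^+ 2 * E 1)).
  by rewrite exprSr; apply: fps_eqmodM => //; apply: fps_eqmodX; apply: qpoch_eqmod.
rewrite qpoch_sqr mulr_suml; apply: fps_eqmod_sum => -[j /= jn] _.
rewrite -[X in fps_eqmod _ _ X]mulr1 -!mulrA.
do 2![apply: fps_eqmodM => //].
(* The q-binomial is exact only to order n - j + 1; the factor q^(j(j+1)/2) restores the missing j
   orders. *)
apply: (@fps_eqmod_leq _ (n - j + 1 + 'C(j.+1, 2))); first by rewrite binS2; lia.
by apply: fps_eqmodMql; apply: qbin_eqmod; lia.
Qed.

(** * The 5-dissection of the Euler product *)

Section Expansion.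
Variables (S T : comNzRingType) (d : {rmorphism S -> T}) (q : T) (a b c : S).
Let e := d a - q * d b - q ^+ 2 * d c.

(** With [d = dil], these four identities sort q^(5-k) e^k by powers of q with coefficients that are
    series in q^5, so that a section can be read off term by term. *)
Lemma trinomial_exp1 : q ^+ 4 * e ^+ 1 = q ^+ 4 * d a - q ^+ 5 * d b - q ^+ 6 * d c.
Proof. by rewrite /e; ring. Qed.

Lemma trinomial_exp2 : q ^+ 3 * e ^+ 2 =
  q ^+ 3 * d (a ^+ 2) - q ^+ 4 * d (2 * a * b) + q ^+ 5 * d (b ^+ 2 - 2 * (a * c))
  + q ^+ 6 * d (2 * b * c) + q ^+ 7 * d (c ^+ 2).
Proof. by rewrite /e; ring. Qed.

Lemma trinomial_exp3 : q ^+ 2 * e ^+ 3 =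
  q ^+ 2 * d (a ^+ 3) - q ^+ 3 * d (3 * a ^+ 2 * b)
  + q ^+ 4 * d (3 * (a * (b ^+ 2 - a * c)))
  + q ^+ 5 * d (6 * (a * c) * b - b ^+ 3)
  + q ^+ 6 * d (3 * a * c ^+ 2 - 3 * b ^+ 2 * c)
  - q ^+ 7 * d (3 * b * c ^+ 2) - q ^+ 8 * d (c ^+ 3).
Proof. by rewrite /e; ring. Qed.

Lemma trinomial_exp4 : q * e ^+ 4 =
  q * d (a ^+ 4) - q ^+ 2 * d (4 * a ^+ 3 * b)
  + q ^+ 3 * d (6 * a ^+ 2 * b ^+ 2 - 4 * a ^+ 3 * c)
  + q ^+ 4 * d (12 * a ^+ 2 * b * c - 4 * a * b ^+ 3)
  + q ^+ 5 * d (b ^+ 4 - 12 * (a * c) * b ^+ 2 + 6 * (a * c) ^+ 2)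
  + q ^+ 6 * d (4 * b ^+ 3 * c - 12 * a * b * c ^+ 2)
  + q ^+ 7 * d (6 * b ^+ 2 * c ^+ 2 - 4 * a * c ^+ 3)
  + q ^+ 8 * d (4 * b * c ^+ 3) + q ^+ 9 * d (c ^+ 4).
Proof. by rewrite /e; ring. Qed.
End Expansion.

Lemma rmorph_fracX (S T : comUnitRingType) (d : {rmorphism S -> T}) a x y k l :
  y \is a GRing.unit -> d (a * x ^+ k / y ^+ l) = d a * d x ^+ k / d y ^+ l.
Proof. by move=> uy; rewrite !rmorphM rmorphV ?unitrX// !rmorphXn. Qed.

HB.instance Definition _ (R : comNzRingType) :=
  GRing.isZmodMorphism.Build (fps R) (fps R) (@dil R)
    (fun a b => etrans (dilD a (- b)) (congr1 _ (dilN b))).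
HB.instance Definition _ (R : comNzRingType) :=
  GRing.isMonoidMorphism.Build (fps R) (fps R) (@dil R) (dil1 R, @dilM R).

Lemma sect_sign (R : comNzRingType) r n (a : fps R) :
  sect r ((-1) ^+ n * a) = (-1) ^+ n * sect r a.
Proof. by rewrite -signr_odd; case: odd; rewrite ?mul1r// expr1 !mulN1r sectN. Qed.

Lemma dil_sign (R : comNzRingType) n (a : fps R) :
  dil ((-1) ^+ n * a) = (-1) ^+ n * dil a.
Proof. by rewrite -signr_odd; case: odd; rewrite ?mul1r// expr1 !mulN1r dilN. Qed.

Lemma sect1 (R : comNzRingType) r : (r < 5)%N -> sect r (1 : fps R) = (r == 0%N)%:R.
Proof. by move=> r5; rewrite -[in LHS](dil1 R) sect_dil//; case: r r5. Qed.

(** Generalised pentagonal numbers are 0, 1 or 2 modulo 5. *)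
Lemma sect_pentagonal34 r n : (2 < r < 5)%N -> sect r (pentagonal n) = 0.
Proof.
move=> /andP[r2 r5]; rewrite sectD sect1// (_ : r == 0%N = false) ?add0r; last by lia.
rewrite sect_sum big1// => -[s /= _] _; rewrite sect_sign sectD !sect_q//.
(* The binomial is known only through its double; with the index written 5t + u, each of the five
   values of u leaves a congruence. *)
have := sqr_bin2 s.+1; rewrite (binS2 s.+1).
move: ('C(s.+1, 2)) => C h.
have := divn_eq s.+1 5; have := ltn_pmod s.+1 (isT : 0 < 5)%N.
move: (s.+1 %/ 5)%N (s.+1 %% 5)%N => t u u5 e; rewrite e in h *.
have h' : (2 * C + 5 * t + u = 25 * (t * t) + 10 * (t * u) + u * u)%N by lia.
have [h1 h2] : (((t * 5 + u) * (t * 5 + u) + C) %% 5 <> r)%N /\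
   (((t * 5 + u) * (t * 5 + u) + (C + (t * 5 + u))) %% 5 <> r)%N.
  clear e h; case: u u5 h' => [|[|[|[|[|//]]]]] _ h'; split; lia.
by rewrite !ifF ?addr0 ?mulr0//; apply/eqP.
Qed.

Lemma sect_pentagonal_term s : (s %% 5)%N \in [:: 0; 2; 3]%N ->
  sect 1 (pentagonal_term s) = 0.
Proof.
move=> s5; rewrite /pentagonal_term sect_sign sectD !sect_q//.
have := sqr_bin2 s; rewrite (binS2 s); move: ('C(s, 2)) => C h.
move: s5; have := divn_eq s 5; have := ltn_pmod s (isT : 0 < 5)%N.
move: (s %/ 5)%N (s %% 5)%N => t u u5 e ur; rewrite e in h *.
have h' : (2 * C + 5 * t + u = 25 * (t * t) + 10 * (t * u) + u * u)%N by lia.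
have [h1 h2] : (((t * 5 + u) * (t * 5 + u) + C) %% 5 <> 1)%N /\
   (((t * 5 + u) * (t * 5 + u) + (C + (t * 5 + u))) %% 5 <> 1)%N.
  clear e h; case: u u5 h' ur => [|[|[|[|[|//]]]]] // _ h' _; split; lia.
by rewrite !ifF ?addr0 ?mulr0//; apply/eqP.
Qed.

Lemma odd_mul5 t : (-1) ^+ (5 * t) = (-1) ^+ t :> fps int.
Proof. by rewrite -signr_odd oddM signr_odd. Qed.

(** The indices [5t - 1] and [5t + 1] are those for which a generalised
    pentagonal number is [1] modulo [5]. *)
Lemma sect_pentagonal_pair t :
  sect 1 (pentagonal_term (5 * t + 4)) + sect 1 (pentagonal_term (5 * t + 6)) =
  - dil (pentagonal_term t.+1).
Proof.
rewrite /pentagonal_term !sect_sign dil_sign !sectD dilD !sect_q// !dil_q.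
rewrite (exprD _ (5 * t) 4) (exprD _ (5 * t) 6) !odd_mul5.
have := sqr_bin2 (5 * t + 4); have := sqr_bin2 (5 * t + 6); have := sqr_bin2 t.+1.
rewrite (binS2 (_ + 4)) (binS2 (_ + 6)) (binS2 t.+1).
move: 'C(5 * t + 4, 2) 'C(5 * t + 6, 2) 'C(t.+1, 2) => c4 c6 c h h6 h4.
have e4 : (2 * c4 = 25 * (t * t) + 35 * t + 12)%N by lia.
have e6 : (2 * c6 = 25 * (t * t) + 55 * t + 30)%N by lia.
have e : (2 * c = t * t + t)%N by lia.
have -> : (((5 * t + 4) * (5 * t + 4) + c4) %% 5 == 1)%N = false by apply/eqP; lia.
have -> : (((5 * t + 6) * (5 * t + 6) + (c6 + (5 * t + 6))) %% 5 == 1)%N = false by apply/eqP; lia.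
have -> : (((5 * t + 4) * (5 * t + 4) + (c4 + (5 * t + 4))) %% 5 == 1)%N by apply/eqP; lia.
have -> : (((5 * t + 6) * (5 * t + 6) + c6) %% 5 == 1)%N by apply/eqP; lia.
have -> : (((5 * t + 4) * (5 * t + 4) + (c4 + (5 * t + 4))) %/ 5 = 5 * (t.+1 * t.+1 + c))%N by lia.
have -> : (((5 * t + 6) * (5 * t + 6) + c6) %/ 5 = 5 * (t.+1 * t.+1 + (c + t.+1)))%N by lia.
rewrite (exprS _ t); move: ('q^_) ('q^(5 * (t.+1 * t.+1 + c))) ((-1) ^+ t).
by move=> x y z /=; ring.
Qed.

(** Each step of the induction adds the five indices 5n + 3 to 5n + 7; only 5n + 4 and 5n + 6 reach
    the residue 1, and together they give one dilated pentagonal term. *)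
Lemma sect_pentagonal1 n : sect 1 (pentagonal (5 * n + 2)) = - dil (pentagonal n).
Proof.
elim: n => [|n IH].
  rewrite /pentagonal 2!big_ord_recr !big_ord0 /= /pentagonal_term add0r addr0.
  rewrite !sectD sect1// !sect_sign !sectD !sect_q//= dil1 fps_q0.
  by ring.
have -> : (5 * n.+1 + 2 = (5 * n + 2).+4.+1)%N by lia.
rewrite /pentagonal 5?[in LHS]big_ord_recr/= !addrA -/(pentagonal _) 5!sectD.
rewrite IH -![(5 * n + 2).+1]addnS -!addnS.
rewrite (@sect_pentagonal_term (5 * n + 3)) ?(@sect_pentagonal_term (5 * n + 5))
   ?(@sect_pentagonal_term (5 * n + 7)) ?addr0.
- rewrite -addrA sect_pentagonal_pair big_ord_recr/= addrA -/(pentagonal _).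
  by rewrite [in RHS]dilD opprD.
- by rewrite mulnC modnMDl.
- by rewrite mulnC modnMDl.
- by rewrite mulnC modnMDl.
Qed.

Lemma E1_sect1 : sect 1 (E 1) = - E 5.
Proof.
apply/fpsP => n.
transitivity (sect 1 (pentagonal (5 * n + 2)) n).
  by apply: E1_pentagonal; lia.
rewrite sect_pentagonal1 -(@dil_E 1)// !fps_coefN; congr (- _).
rewrite /=; case: ifP => // _; apply/esym/E1_pentagonal.
by rewrite ltnS leq_div.
Qed.

Lemma E1_sect34 r : (2 < r < 5)%N -> sect r (E 1) = 0.
Proof.
move=> r25; apply/fpsP => n; rewrite -(@sect_pentagonal34 r (5 * n + r))//.
exact: E1_pentagonal.
Qed.

(** Triangular numbers are 0, 1 or 3 modulo 5, never 2. *)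
Lemma E1_cube_sect2 : sect 2 (E 1 ^+ 3) = 0.
Proof.
apply/fpsP => n; transitivity (sect 2 (jacobi (5 * n + 2)) n).
  exact: E1_cube.
move: (5 * n + 2)%N => N; congr (fps_coef _ n).
rewrite sect_sum big1// => -[s /= _] _; rewrite -mulrA sect_sign.
rewrite -[(_)%:R]/((s + s + 1)%:Z%:~R) sect_intr sect_q// ifF ?mulr0//; apply/eqP.
rewrite binS2; have := sqr_bin2 s; move: 'C(s, 2) => C h.
have := divn_eq s 5; have := ltn_pmod s (isT : 0 < 5)%N.
move: (s %/ 5)%N (s %% 5)%N => t u u5 e; rewrite e in h *.
have {}h : (2 * C + 5 * t + u = 25 * (t * t) + 10 * (t * u) + u * u)%N by lia.
clear e; case: u u5 h => [|[|[|[|[|//]]]]] _ h; lia.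
Qed.

Lemma sectMq (R : comNzRingType) r k (a : fps R) : sect (r + k) ('q^k * a) = sect r a.
Proof.
apply/fpsP => n; transitivity (('q^k * a) (5 * n + r + k)%N); first by rewrite -addnA.
by rewrite fps_coefMq ltnNge leq_addl/= addnK.
Qed.

(** The series A and C of the dissection are [dil dissA] and [dil dissC]. *)
Definition dissA : fps int := sect 0 (E 1).
Definition dissC : fps int := - sect 2 (E 1).

Lemma E1_dissection : E 1 = dil dissA - 'q^1 * E 25 - 'q^2 * dil dissC.
Proof.
rewrite {1}[E 1]dil_dissection !big_ord_recr big_ord0/= E1_sect1 (@E1_sect34 3)// (@E1_sect34 4)//.
rewrite (_ : sect 2 (E 1) = - dissC) ?opprK// -/dissA.
rewrite !dilN (@dil_E 5)// fps_q0 (_ : dil 0 = 0); last by apply/fpsP => n /=; case: ifP.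
by ring.
Qed.

(** The section of residue 2 of E_1^3 is, by the trinomial expansion, 3 a (b^2 - a c) with a =
    [dissA], b = E_5, c = [dissC]. It vanishes, a has constant term 1, and 3 cancels in integer
    coefficients. *)
Lemma dissAC : dissA * dissC = E 5 ^+ 2.
Proof.
have := E1_cube_sect2; rewrite -(sectMq 2 2) E1_dissection -(@dil_E 5)//.
rewrite -(fps_qX _ 1 2) (trinomial_exp3 (@dil int)) !fps_qX !mul1n.
rewrite !(sectD, sectN) !sect_qdil//= fps_q0 mul1r !(oppr0, addr0, add0r).
move: (E 5) dissC => b c h.
have ua : dissA \is a GRing.unit by apply: fps_unit1; rewrite [LHS]/= E_coef0.
have {}h : 3%:~R * (b ^+ 2 - dissA * c) = 0.
  by apply: (mulrI ua); rewrite mulr0 -h; ring.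
apply/esym/eqP; rewrite -subr_eq0; apply/eqP/fpsP => n.
have /fpsP/(_ n) := h; rewrite fps_coef_intr => /eqP; rewrite mulf_eq0/=.
by move/eqP.
Qed.

(** * The modular equation of degree 5 *)

Section FifthRoots.
Variable R : comNzRingType.
Implicit Types u v x y z a b c : R.

(** A root of the fifth cyclotomic polynomial, a condition that passes from R to constant series
    over R. *)
Definition fifth_root z := 1 + z + z ^+ 2 + z ^+ 3 + z ^+ 4 = 0.

Lemma fifth_root_exp5 z : fifth_root z -> z ^+ 5 = 1.
Proof.
move=> hz; apply/eqP; rewrite -subr_eq0; apply/eqP.
transitivity ((z - 1) * (1 + z + z ^+ 2 + z ^+ 3 + z ^+ 4)); first by ring.
by rewrite hz mulr0.
Qed.

Lemma exp_mod5 z n : z ^+ 5 = 1 -> z ^+ n = z ^+ (n %% 5).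
Proof. by move=> z5; rewrite {1}(divn_eq n 5) exprD mulnC exprM z5 expr1n mul1r. Qed.

Lemma fifth_root_exp z n : fifth_root z -> ~~ (5 %| n)%N -> fifth_root (z ^+ n).
Proof.
move=> hz n5; rewrite /fifth_root; have z5 := fifth_root_exp5 hz.
rewrite (exp_mod5 n z5); move: n5 (ltn_pmod n (isT : 0 < 5)%N); rewrite /dvdn.
rewrite -[RHS]hz -!exprM.
case: (n %% 5)%N => [|[|[|[|[|//]]]]] // _ _; rewrite ?mul1n ?expr1//.
- by rewrite (exp_mod5 (2 * 3) z5) (exp_mod5 (2 * 4) z5)/= expr1; ring.
- rewrite (exp_mod5 (3 * 2) z5) (exp_mod5 (3 * 3) z5) (exp_mod5 (3 * 4) z5)/= expr1; ring.
- rewrite (exp_mod5 (4 * 2) z5) (exp_mod5 (4 * 3) z5) (exp_mod5 (4 * 4) z5)/= expr1; ring.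
Qed.

Lemma fifth_root_prod z x : fifth_root z -> \prod_(i < 5) (1 - z ^+ i * x) = 1 - x ^+ 5.
Proof.
move=> hz; rewrite !big_ord_recr big_ord0 /= mul1r.
have z5 := fifth_root_exp5 hz; have z6 := exp_mod5 6 z5.
have e14 : (1 - z * x) * (1 - z ^+ 4 * x) = 1 - (z + z ^+ 4) * x + x ^+ 2.
  by transitivity (1 - (z + z ^+ 4) * x + z ^+ 5 * x ^+ 2); [ring|rewrite z5; ring].
have e23 : (1 - z ^+ 2 * x) * (1 - z ^+ 3 * x) = 1 + (1 + (z + z ^+ 4)) * x + x ^+ 2.
  transitivity (1 - ((1 + z + z ^+ 2 + z ^+ 3 + z ^+ 4) - 1 - (z + z ^+ 4)) * x
    + z ^+ 5 * x ^+ 2); first by ring.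
  by rewrite z5 hz; ring.
have f2 : (z + z ^+ 4) ^+ 2 = 1 - (z + z ^+ 4).
  transitivity (z ^+ 2 + z ^+ 5 *+ 2 + z ^+ 5 * z ^+ 3); first by ring.
  rewrite z5 -[LHS]subr0 -hz; ring.
rewrite expr0 expr1 !mul1r.
transitivity ((1 - x) * ((1 - z * x) * (1 - z ^+ 4 * x)) *
  ((1 - z ^+ 2 * x) * (1 - z ^+ 3 * x))); first by ring.
rewrite e14 e23; move: (z + _) f2 => f f2.
transitivity ((1 - x) * ((1 + x ^+ 2) ^+ 2 + (1 + x ^+ 2) * x - f * x ^+ 2 - f ^+ 2 * x ^+ 2)).
  by ring.
by rewrite f2; ring.
Qed.

(** Conjugate factors multiply to U + f V and U - (1 + f) V, where f = z + z^4 satisfies f^2 + f =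
    1; their product U^2 - U V - V^2 is free of z. *)
Lemma fifth_root_norm z a b c : fifth_root z -> a * c = b ^+ 2 ->
  \prod_(i < 5) (a - z ^+ i * b - (z ^+ i) ^+ 2 * c) =
  let e := a - b - c in
  e * (e ^+ 4 + 5 * b * e ^+ 3 + 15 * b ^+ 2 * e ^+ 2 + 25 * b ^+ 3 * e + 25 * b ^+ 4).
Proof.
move=> hz ac /=; set e := a - b - c; rewrite !big_ord_recr big_ord0 /= mul1r.
have z5 := fifth_root_exp5 hz; have z6 := exp_mod5 6 z5; have z8 := exp_mod5 8 z5.
rewrite expr0 expr1 expr1n !mul1r -/e -!exprM.
rewrite (exp_mod5 (3 * 2) z5) (exp_mod5 (4 * 2) z5)/= expr1.
pose f := z + z ^+ 4; pose U := a ^+ 2 + 2 * b ^+ 2 + c ^+ 2.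
pose V := b * c - a * b + b ^+ 2.
have fE : z ^+ 2 + z ^+ 3 = - 1 - f.
  by rewrite /f -[LHS]subr0 -hz; ring.
have f2 : f ^+ 2 = 1 - f.
  transitivity (z ^+ 2 + z ^+ 5 *+ 2 + z ^+ 5 * z ^+ 3); first by rewrite /f; ring.
  by rewrite z5 mul1r addrAC fE; ring.
have e14 : (a - z * b - z ^+ 2 * c) * (a - z ^+ 4 * b - z ^+ 3 * c) = U + f * V.
  transitivity (a ^+ 2 + z ^+ 5 * b ^+ 2 + z ^+ 5 * c ^+ 2 - f * (a * b)
    - (z ^+ 2 + z ^+ 3) * (a * c) + (z ^+ 4 + z ^+ 5 * z) * (b * c)); first by rewrite /f; ring.
  by rewrite z5 fE ac !mul1r (addrC (z ^+ 4)) -/f /U /V; ring.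
have e23 : (a - z ^+ 2 * b - z ^+ 4 * c) * (a - z ^+ 3 * b - z * c) = U - (1 + f) * V.
  transitivity (a ^+ 2 + z ^+ 5 * b ^+ 2 + z ^+ 5 * c ^+ 2 - (z ^+ 2 + z ^+ 3) * (a * b)
    - f * (a * c) + (z ^+ 3 + z ^+ 5 * z ^+ 2) * (b * c)); first by rewrite /f; ring.
  by rewrite z5 !mul1r (addrC (z ^+ 3)) fE ac /U /V; ring.
transitivity (e * ((a - z * b - z ^+ 2 * c) * (a - z ^+ 4 * b - z ^+ 3 * c))
   * ((a - z ^+ 2 * b - z ^+ 4 * c) * (a - z ^+ 3 * b - z * c))); first by ring.
rewrite e14 e23 -mulrA; congr (_ * _).
transitivity (U ^+ 2 - U * V - (f + f ^+ 2) * V ^+ 2); first by ring.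
rewrite f2 (addrC f) subrK mul1r -[RHS]addr0.
(* The two sides differ by a multiple of a c - b^2; the second factor is the explicit cofactor. *)
have <- : (a * c - b ^+ 2) * (4 * a ^+ 2 + 4 * c ^+ 2 + 10 * b ^+ 2 - 4 * a * c
    + 2 * a * b - 2 * b * c) = 0 by rewrite ac subrr mul0r.
by rewrite /U /V /e; ring.
Qed.

End FifthRoots.

Section Twist.
Variable R : comNzRingType.

(** The substitution q -> w q; for w = 1 it is merely the change of coefficient ring from [int] to
    [R]. *)
Definition twist (w : R) (a : fps int) : fps R := FPS (fun n => w ^+ n * (a n)%:~R).
Definition cst (w : R) : fps R := FPS (fun n => if n == 0%N then w else 0).

Lemma twistM w a b : twist w (a * b) = twist w a * twist w b.
Proof.
apply/fpsP => n; rewrite [LHS]/= fps_coefM rmorph_sum mulr_sumr.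
apply: eq_bigr => i _; rewrite rmorphM/=.
have -> : w ^+ n = w ^+ i * w ^+ (n - i).
  by rewrite -exprD; congr (_ ^+ _); have := ltn_ord i; lia.
by ring.
Qed.

Lemma twistB w a b : twist w (a - b) = twist w a - twist w b.
Proof. by apply/fpsP => n; rewrite /= rmorphB mulrBr. Qed.

Lemma twistD w a b : twist w (a + b) = twist w a + twist w b.
Proof. by apply/fpsP => n; rewrite /= rmorphD mulrDr. Qed.

Lemma twist1 w : twist w 1 = 1.
Proof. by apply/fpsP => -[|n] /=; rewrite ?expr0 ?mulr1// mulr0. Qed.

Lemma twistX w a k : twist w (a ^+ k) = twist w a ^+ k.
Proof. by elim: k => [|k IH]; rewrite ?expr0 ?twist1// !exprS twistM IH. Qed.

Lemma twist_natr w k : twist w k%:R = k%:R.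
Proof.
elim: k => [|k IH]; last by rewrite !mulrS twistD twist1 IH.
by apply/fpsP => n /=; rewrite mulr0.
Qed.

Lemma cstM u v : cst (u * v) = cst u * cst v.
Proof.
apply/fpsP => n; rewrite fps_coefM big_ord_recl big1 ?addr0/=.
  by rewrite subn0; case: eqP => // _; rewrite mulr0.
by move=> i _; rewrite mul0r.
Qed.

Lemma cstD u v : cst (u + v) = cst u + cst v.
Proof. by apply/fpsP => n /=; case: eqP => // _; rewrite addr0. Qed.

Lemma cst1 : cst 1 = 1.
Proof. by apply/fpsP => -[|n]. Qed.

Lemma cstX u k : cst (u ^+ k) = cst u ^+ k.
Proof. by elim: k => [|k IH]; rewrite ?expr0 ?cst1// !exprS cstM IH. Qed.

Lemma cst_fifth_root z : fifth_root z -> fifth_root (cst z).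
Proof.
rewrite /fifth_root => hz; rewrite -cst1 -!cstX -!cstD hz.
by apply/fpsP => -[|n].
Qed.

Lemma twist_q w k : twist w 'q^k = cst w ^+ k * 'q^k.
Proof.
apply/fpsP => n; rewrite mulrC fps_coefMq -cstX /=.
case: ltnP => nk; first by rewrite ltn_eqF// mulr0.
rewrite subn_eq0; have [<-|nk'] := eqVneq n k; first by rewrite leqnn mulr1.
by rewrite mulr0 leqNgt ltn_neqAle eq_sym nk' nk.
Qed.

Lemma twist_dil w a : w ^+ 5 = 1 -> twist w (dil a) = twist 1 (dil a).
Proof.
move=> w5; apply/fpsP => n /=; case: ifP => [/dvdnP[k ->]|_]; last by rewrite !mulr0.
by rewrite mulnC !exprM w5 !expr1n.
Qed.

Lemma twist_eqmod w n a b : fps_eqmod n a b -> fps_eqmod n (twist w a) (twist w b).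
Proof. by move=> ab k kn /=; rewrite ab. Qed.

Variable z : R.
Hypothesis hz : fifth_root z.

Definition norm5 a := \prod_(i < 5) twist (z ^+ i) a.

Lemma norm5M a b : norm5 (a * b) = norm5 a * norm5 b.
Proof. by rewrite -big_split; apply: eq_bigr => i _; rewrite twistM. Qed.

(** If 5 divides n, the five twisted factors coincide; otherwise z^n is again a root of the
    cyclotomic polynomial and [fifth_root_prod] applies. *)
Lemma norm5_q n : norm5 (1 - 'q^n) =
  twist 1 (if (5 %| n)%N then (1 - 'q^n) ^+ 5 else 1 - 'q^(5 * n)).
Proof.
pose y := cst z ^+ n.
have -> : norm5 (1 - 'q^n) = \prod_(i < 5) (1 - y ^+ i * 'q^n).
  apply: eq_bigr => i _; rewrite twistB twist1 twist_q cstX -exprM mulnC exprM.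
  by [].
case: ifP => [/dvdnP[k nk]|n5].
  have -> : y = 1.
    by rewrite /y nk mulnC exprM (fifth_root_exp5 (cst_fifth_root hz)) expr1n.
  rewrite twistX twistB twist1 twist_q cst1 expr1n mul1r.
  by under eq_bigr do rewrite expr1n mul1r; rewrite prodr_const card_ord.
rewrite fifth_root_prod; last first.
  by apply: fifth_root_exp; [exact: cst_fifth_root|rewrite n5].
by rewrite twistB twist1 twist_q cst1 expr1n mul1r fps_qX mulnC.
Qed.

Let qprod j n : fps int := \prod_(1 <= i < n.+1) (1 - 'q^(j * i)).

Let qprodS j n : qprod j n.+1 = qprod j n * (1 - 'q^(j * n.+1)).
Proof. by rewrite /qprod big_nat_recr. Qed.

(** Indices prime to 5 contribute 1 - q^(5n); the factor [qprod 25 M] supplies the missing multiples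
    of 5, whose own norms form [qprod 5 M ^+ 5]. *)
Lemma norm5_qpoch M :
  norm5 (qpoch (5 * M)) * twist 1 (qprod 25 M) =
  twist 1 (qprod 5 (5 * M) * qprod 5 M ^+ 5).
Proof.
elim: M => [|M IH].
  rewrite muln0 /qprod !big_geq// qpoch0 expr1n mulr1 twist1 mulr1.
  by rewrite /norm5 big1// => i _; rewrite twist1.
have -> : (5 * M.+1 = (5 * M).+4.+1)%N by lia.
rewrite 5!qpochS 5!norm5M !norm5_q 7!qprodS.
have -> : (5 %| (5 * M).+1)%N = false by lia.
have -> : (5 %| (5 * M).+2)%N = false by lia.
have -> : (5 %| (5 * M).+3)%N = false by lia.
have -> : (5 %| (5 * M).+4)%N = false by lia.
have -> : (5 %| (5 * M).+4.+1)%N by lia.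
have -> : (25 * M.+1 = 5 * (5 * M).+4.+1)%N by lia.
have -> : (5 * M.+1 = (5 * M).+4.+1)%N by lia.
rewrite exprMn !twistM; move: IH; rewrite twistM twistX.
move: (twist 1 (qprod 25 M)) (twist 1 (qprod 5 M)) (twist 1 (qprod 5 (5 * M))) (norm5 _).
move=> x v u y IH.
move: (twist _ _) (twist _ _) (twist _ _) (twist _ _) (twist _ _) (twist _ _).
move=> a b c d e f.
transitivity (b ^+ 5 * a * c * d * e * f * (y * x)); first by ring.
by rewrite IH; ring.
Qed.

Lemma norm5_E1 : norm5 (E 1) * twist 1 (E 25) = twist 1 (E 5 ^+ 6).
Proof.
have qprod_E j n N : (0 < j)%N -> (n <= N.+1)%N -> fps_eqmod n (E j) (qprod j N).
  exact: E_eqmod.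
apply: fps_eqmod_eq => n.
apply: (@fps_eqmod_trans _ _ (norm5 (qpoch (5 * n)) * twist 1 (qprod 25 n))).
  apply: fps_eqmodM; last by apply: twist_eqmod; apply: qprod_E.
  apply: fps_eqmod_prod => i _; apply: twist_eqmod; apply: qpoch_eqmod; lia.
rewrite norm5_qpoch; apply/fps_eqmod_sym/twist_eqmod; rewrite exprS.
by apply: fps_eqmodM; [|apply: fps_eqmodX]; apply: qprod_E; lia.
Qed.

End Twist.

Lemma algC_fifth_root : exists z : algC, fifth_root z.
Proof.
have [z z5] := C_prim_root_exists (n := 5) isT; exists z.
have z1 : z - 1 != 0.
  by rewrite subr_eq0 -[z in z == _]expr1 -(prim_order_dvd z5).
apply: (mulfI z1); rewrite mulr0 -(subrr 1) -{3}(prim_expr_order z5).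
ring.
Qed.

(** Brings an identity proved over [algC], where z lives, back to integer series. *)
Lemma twist1_inj : injective (@twist algC 1).
Proof.
move=> a b /fpsP ab; apply/fpsP => n; have := ab n.
by rewrite /= expr1n !mul1r => /intr_inj.
Qed.

(** The degree-5 modular equation between [q E_25 / E_1] and
    [q^5 E_25^6 / E_5^6], with denominators cleared. *)
Lemma modular_equation :
  let b := 'q^1 * E 25 in
  E 25 * E 1 * (E 1 ^+ 4 + 5 * b * E 1 ^+ 3 + 15 * b ^+ 2 * E 1 ^+ 2
    + 25 * b ^+ 3 * E 1 + 25 * b ^+ 4) = E 5 ^+ 6.
Proof.
move=> b; have [z hz] := algC_fifth_root.
have z5 i : (z ^+ i) ^+ 5 = 1 by rewrite -exprM mulnC exprM (fifth_root_exp5 hz) expr1n.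
apply: twist1_inj; rewrite -(norm5_E1 hz) -[E 25 * E 1 * _]mulrA twistM [RHS]mulrC.
congr (_ * _); rewrite /norm5.
(* A, C and E_25 are series in q^5, so only the prefactors q and q^2 acquire roots of unity. *)
transitivity (\prod_(i < 5) (twist 1 (dil dissA) - (cst z) ^+ i * twist 1 b
   - (cst z ^+ i) ^+ 2 * twist 1 ('q^2 * dil dissC))); last first.
  apply: eq_bigr => i _; rewrite {1}E1_dissection !twistB !twistM -(@dil_E 5)//.
  rewrite !(twist_dil _ (z5 i)) !twist_q cst1 !expr1n !mul1r !cstX.
  by rewrite expr1 !mulrA.
rewrite fifth_root_norm/=; last 2 first.
- exact: cst_fifth_root.
- rewrite -twistM -twistX mulrCA -dilM dissAC dilX (@dil_E 5)// /b.
  by rewrite exprMn fps_qX.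
rewrite -!twistB (_ : dil dissA - b - 'q^2 * dil dissC = E 1); last first.
  by rewrite [RHS]E1_dissection.
have tn k : k%:R = twist 1 k%:R :> fps algC by rewrite twist_natr.
by rewrite !tn -!(twistX, twistM, twistD).
Qed.

(** * Sections of the powers of xi *)

(** [xi] is x; y is [dil tau], so a section turns a factor y into [tau]. *)
Definition xi : fps int := 'q^1 * E 25 / E 1.
Definition tau : fps int := 'q^1 * E 5 ^+ 6 / E 1 ^+ 6.

Lemma dil_tau : dil tau = 'q^5 * E 25 ^+ 6 / E 5 ^+ 6.
Proof.
have e1 : dil (E 1) = E 5 by rewrite dil_E.
have e5 : dil (E 5) = E 25 by rewrite dil_E.
rewrite -[E 25]e5 -[X in X ^- 6]e1 -['q^5](dil_q _ 1).
exact: (rmorph_fracX (@dil int) _ _ _ _ (E_unit (isT : 0 < 1)%N)).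
Qed.

Lemma xi5 : xi ^+ 5 =
  dil tau * (1 + 5 * xi + 15 * xi ^+ 2 + 25 * xi ^+ 3 + 25 * xi ^+ 4).
Proof.
have ei := divrr (E_unit (isT : 0 < 1)%N).
have f5 : E 5 ^+ 6 / E 5 ^+ 6 = 1 by rewrite divrr// unitrX ?E_unit.
rewrite dil_tau /xi -(fps_qX _ 1 5).
have := modular_equation; rewrite /=.
move: ((E 5 ^+ 6)^-1) f5 => j f5 eq.
move: eq (E 1)^-1 ei f5 => <- i.
move: ('q^1) (E 25) (E 1) => q f e ei /esym f5.
rewrite -[LHS]mulr1 {1}f5.
transitivity (q ^+ 5 * f ^+ 6 * j * ((e * i) ^+ 5 + 5 * (q * f) * (e * i) ^+ 4 * i
  + 15 * (q * f) ^+ 2 * (e * i) ^+ 3 * i ^+ 2 + 25 * (q * f) ^+ 3 * (e * i) ^+ 2 * i ^+ 3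
  + 25 * (q * f) ^+ 4 * (e * i) * i ^+ 4)); first by ring.
by rewrite ei; ring.
Qed.

(** [q^5] times the [k]-th power of [1 / xi] is a power series for [k <= 5]. *)
Definition xi_inv k : fps int := 'q^(5 - k) * (E 1 / E 25) ^+ k.

Lemma xi_inv_xi k : (k < 5)%N -> xi_inv k.+1 * xi = xi_inv k.
Proof.
move=> k5; rewrite /xi_inv /xi exprS.
have -> : 'q^(5 - k) = 'q^(5 - k.+1) * 'q^1 :> fps int.
  by rewrite -fps_qD; congr fpsXn; lia.
have e1 := divrr (E_unit (isT : 0 < 1)%N); have e25 := divrr (E_unit (isT : 0 < 25)%N).
transitivity ('q^(5 - k.+1) * 'q^1 * (E 1 / E 25) ^+ k * (E 1 / E 1) * (E 25 / E 25)).
  by ring.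
by rewrite e1 e25 !mulr1.
Qed.

(** E_25^k factors out as a series in q^5, and only the q^5 term of the expansion survives. With a c
    = b^2 its coefficient is b^k times 1, -1, -1, 5, -5. *)
Lemma sect_xi_inv k : (k < 5)%N ->
  sect 0 (xi_inv k) = (nth 0 [:: 1; -1; -1; 5; -5] k)%:~R * 'q^1.
Proof.
move=> k5; rewrite /xi_inv exprMn.
rewrite -(@dil_E 5)// -dilV ?E_unit// -dilX mulrA mulrC sect_dilM//.
have u5k : E 5 ^+ k \is a GRing.unit by rewrite unitrX ?E_unit.
rewrite exprVn; apply: (mulrI u5k); rewrite mulVKr//.
have AC := dissAC; move: k5 {u5k}.
set b := E 5 in AC *; set a := dissA in AC *; set c := dissC in AC *.
have E1E : E 1 = dil a - 'q^1 * dil b - 'q^1 ^+ 2 * dil c.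
  by rewrite E1_dissection -(@dil_E 5)// fps_qX.
clearbody a b c.
have sq i x : sect 0 ('q^i * dil x) = if (i %% 5 == 0)%N then 'q^(i %/ 5) * x else 0 :> fps int.
  exact: sect_qdil.
case: k => [|[|[|[|[|//]]]]] _ /=.
- by rewrite !expr0 mul1r mulr1 sect_q// mul1r.
- rewrite -[(5 - 1)%N]/4%N E1E -(fps_qX _ 1 4) (trinomial_exp1 (@dil int)) !fps_qX !mul1n.
  by rewrite !(sectD, sectN) !sq /=; ring.
- rewrite -[(5 - 2)%N]/3%N E1E -(fps_qX _ 1 3) (trinomial_exp2 (@dil int)) !fps_qX !mul1n.
  by rewrite !(sectD, sectN) !sq /= AC; ring.
- rewrite -[(5 - 3)%N]/2%N E1E -(fps_qX _ 1 2) (trinomial_exp3 (@dil int)) !fps_qX !mul1n.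
  by rewrite !(sectD, sectN) !sq /= AC; ring.
- have sect9 x0 x1 x2 x3 x4 x5 x6 x7 x8 :
      sect 0 ('q^1 * dil x0 - 'q^2 * dil x1 + 'q^3 * dil x2 + 'q^4 * dil x3 + 'q^5 * dil x4
        + 'q^6 * dil x5 + 'q^7 * dil x6 + 'q^8 * dil x7 + 'q^9 * dil x8) = 'q^1 * x4 :> fps int.
    by rewrite !(sectD, sectN) !sq /=; ring.
  rewrite -[(5 - 4)%N]/1%N E1E (trinomial_exp4 (@dil int)) !fps_qX !mul1n.
  by rewrite sect9 AC; ring.
Qed.

(** The value at [0] is a convention matching [m 0 j = 0], not the section of [xi ^+ 0]. *)
Definition sect_xi i : fps int := if i is 0 then 0 else sect 0 (xi ^+ i).

Lemma sect_xi_rec_big i : (5 <= i)%N -> sect_xi i.+1 = tau * (25 * sect_xi i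
  + 25 * sect_xi (i - 1) + 15 * sect_xi (i - 2) + 5 * sect_xi (i - 3) + sect_xi (i - 4)).
Proof.
move=> i5; have [k ->] : exists k, i = k.+4.+1 by exists (i - 5)%N; lia.
rewrite !subSS !subn0 /sect_xi.
have -> : xi ^+ k.+4.+2 = dil tau * (xi ^+ k.+1 + 5%:~R * xi ^+ k.+2
      + 15%:~R * xi ^+ k.+3 + 25%:~R * xi ^+ k.+4 + 25%:~R * xi ^+ k.+4.+1).
  have -> : xi ^+ k.+4.+2 = xi ^+ 5 * xi ^+ k.+1 by rewrite -exprD.
  by rewrite xi5 !exprS; ring.
by rewrite sect_dilM// !sectD !sect_intr; ring.
Qed.

(** For i < 5 the modular equation times x^(i-4) also involves powers x^k with k <= 0; their
    sections add up to the first column, for instance -5 + 25 - 15 - 25 + 25 = 5 for i = 0. *)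
Lemma sect_xi_rec i : sect_xi i.+1 = tau * ((m i.+1 1)%:~R + 25 * sect_xi i
  + 25 * sect_xi (i - 1) + 15 * sect_xi (i - 2) + 5 * sect_xi (i - 3) + sect_xi (i - 4)).
Proof.
have [i5|i5] := leqP 5 i.
  rewrite sect_xi_rec_big//; congr (_ * _).
  by case: i i5 => [|[|[|[|[|i]]]]] //= _; rewrite add0r.
(* A factor q outside the section is q^5 inside, which turns x^(-k) into the power series
   [xi_inv k]. *)
apply: (@fps_mulqI int 1); rewrite /= -(sect_dilM 'q^1)// dil_q.
have w3 := @xi_inv_xi 3 isT; have w2 := @xi_inv_xi 2 isT.
have w1 := @xi_inv_xi 1 isT; have w0 := @xi_inv_xi 0 isT.
have q5 : 'q^(5 * 1) = xi_inv 0 by rewrite /xi_inv expr0 mulr1.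
have h k := @sect_xi_inv k; rewrite q5.
have hx k : sect 0 (xi_inv 0 * xi ^+ k) = 'q^1 * sect 0 (xi ^+ k).
  by rewrite -q5 -dil_q sect_dilM.
have comb t v0 v1 v2 v3 v4 : sect 0 (dil t * (v0 + 5%:~R * v1 + 15%:~R * v2
    + 25%:~R * v3 + 25%:~R * v4)) = t * (sect 0 v0 + 5 * sect 0 v1 + 15 * sect 0 v2
    + 25 * sect 0 v3 + 25 * sect 0 v4) :> fps int.
  by rewrite sect_dilM// 4!sectD 4!sect_intr.
move: w0 w1 w2 w3 h hx {q5}; move: xi_inv => W w0 w1 w2 w3 h hx.
case: i i5 => [|[|[|[|[|//]]]]] _; rewrite /sect_xi.
- rewrite ?subSS ?sub0n ?subn0 /=.
  have -> : W 0 * xi ^+ 1 = dil tau * (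
      W 4 + 5%:~R * W 3 + 15%:~R * W 2
      + 25%:~R * W 1 + 25%:~R * W 0).
    rewrite -w0 -w1 -w2 -w3.
    transitivity (W 4 * xi ^+ 0 * xi ^+ 5); first by ring.
    by rewrite xi5; ring.
  by rewrite comb ?hx !h//=; ring.
- rewrite ?subSS ?sub0n ?subn0 /=.
  have -> : W 0 * xi ^+ 2 = dil tau * (
      W 3 + 5%:~R * W 2 + 15%:~R * W 1
      + 25%:~R * W 0 + 25%:~R * (W 0 * xi ^+ 1)).
    rewrite -w0 -w1 -w2 -w3.
    transitivity (W 4 * xi ^+ 1 * xi ^+ 5); first by ring.
    by rewrite xi5; ring.
  by rewrite comb ?hx !h//=; ring.
- rewrite ?subSS ?sub0n ?subn0 /=.
  have -> : W 0 * xi ^+ 3 = dil tau * (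
      W 2 + 5%:~R * W 1 + 15%:~R * W 0
      + 25%:~R * (W 0 * xi ^+ 1) + 25%:~R * (W 0 * xi ^+ 2)).
    rewrite -w0 -w1 -w2 -w3.
    transitivity (W 4 * xi ^+ 2 * xi ^+ 5); first by ring.
    by rewrite xi5; ring.
  by rewrite comb ?hx !h//=; ring.
- rewrite ?subSS ?sub0n ?subn0 /=.
  have -> : W 0 * xi ^+ 4 = dil tau * (
      W 1 + 5%:~R * W 0 + 15%:~R * (W 0 * xi ^+ 1)
      + 25%:~R * (W 0 * xi ^+ 2) + 25%:~R * (W 0 * xi ^+ 3)).
    rewrite -w0 -w1 -w2 -w3.
    transitivity (W 4 * xi ^+ 3 * xi ^+ 5); first by ring.
    by rewrite xi5; ring.
  by rewrite comb ?hx !h//=; ring.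
- rewrite ?subSS ?sub0n ?subn0 /=.
  have -> : W 0 * xi ^+ 5 = dil tau * (
      W 0 + 5%:~R * (W 0 * xi ^+ 1) + 15%:~R * (W 0 * xi ^+ 2)
      + 25%:~R * (W 0 * xi ^+ 3) + 25%:~R * (W 0 * xi ^+ 4)).
    rewrite -w0 -w1 -w2 -w3.
    transitivity (W 4 * xi ^+ 4 * xi ^+ 5); first by ring.
    by rewrite xi5; ring.
  by rewrite comb ?hx !h//=; ring.
Qed.

(** * Expansion of the sections in powers of tau *)

Lemma m_0 j : m 0 j = 0. Proof. by case: j. Qed.

Lemma mSS i j : m i.+1 j.+2 = 25 * m i j.+1 + 25 * m (i - 1) j.+1
  + 15 * m (i - 2) j.+1 + 5 * m (i - 3) j.+1 + m (i - 4) j.+1.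
Proof.
transitivity (25 * m (i.+1 - 1) j.+1 + 25 * m (i.+1 - 2) j.+1 + 15 * m (i.+1 - 3) j.+1
  + 5 * m (i.+1 - 4) j.+1 + m (i.+1 - 5) j.+1) => //.
by rewrite !subSS subn0.
Qed.

Lemma m_gt i j : (i < j)%N -> m i j = 0.
Proof.
elim: j i => // -[|j] IH [|i] ij; rewrite ?m_0//.
by rewrite mSS !IH ?mulr0//; lia.
Qed.

Lemma m_col1 : (m 1 1 = 5) * (m 2 1 = 10) * (m 3 1 = 9) * (m 4 1 = 4) * (m 5 1 = 1)
  * (m 6 1 = 0) * (m 7 1 = 0).
Proof. by []. Qed.

(** The first row of [c] is the expansion of the section of xi^7, as the generating function is
    E_1^(-7). *)
Lemma c1_m7 k : (1 <= k)%N -> c 1 k = m 7 k.+1.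
Proof.
case: k => // k _; have [k6|] := leqP 6 k.
  by rewrite m_gt//; do 6![case: k k6 => // k k6].
have mE := (mSS, subSS, subn0, sub0n, m_0, m_col1).
case: k => [_|[_|[_|[_|[_|[_|//]]]]]].
- by transitivity (140 : int); [|rewrite !mE; ring].
- by transitivity (49 * 5 ^+ 4 : int); [|rewrite !mE; ring].
- by transitivity (21 * 5 ^+ 7 : int); [|rewrite !mE; ring].
- by transitivity (91 * 5 ^+ 8 : int); [|rewrite !mE; ring].
- by transitivity (7 * 5 ^+ 11 : int); [|rewrite !mE; ring].
- by transitivity (5 ^+ 13 : int); [|rewrite !mE; ring].
Qed.

Lemma m_sum_rec (R : comNzRingType) (t : R) i N :
  let T k := \sum_(1 <= j < N.+1) (m k j)%:~R * t ^+ j in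
  \sum_(0 <= j < N.+1) (m i.+1 j.+1)%:~R * t ^+ j.+1 =
  t * ((m i.+1 1)%:~R + 25 * T i + 25 * T (i - 1)%N + 15 * T (i - 2)%N
       + 5 * T (i - 3)%N + T (i - 4)%N).
Proof.
move=> T; rewrite big_ltn// expr1 /T !mulr_sumr -!addrA -!big_split mulrDr.
rewrite mulrC mulr_sumr; congr (_ + _); apply: eq_big_nat => -[//|j] _.
by rewrite mSS exprS !(rmorphD, rmorphM)/=; ring.
Qed.

Lemma tauM_eqmod n a b : fps_eqmod n a b -> fps_eqmod n.+1 (tau * a) (tau * b).
Proof.
move=> ab; have -> : tau = 'q^1 * (E 5 ^+ 6 / E 1 ^+ 6) by rewrite mulrA.
rewrite -2!['q^1 * _ * _]mulrA -addn1; apply: fps_eqmodMql.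
by apply: fps_eqmodM.
Qed.

(** Both sides obey the same recurrence ([sect_xi_rec], [m_sum_rec]). Its factor tau has no constant
    term, so each use gains one order of precision. *)
Lemma sect_xi_eqmod i N :
  fps_eqmod N (sect_xi i) (\sum_(1 <= j < N) (m i j)%:~R * tau ^+ j).
Proof.
elim: N i => [//|N IH] [|i]; first by rewrite big1// => j _; rewrite m_0 mul0r.
rewrite sect_xi_rec big_add1 -pred_Sn; case: N IH => [|N] IH.
  rewrite big_geq// -[X in fps_eqmod _ _ X](mulr0 tau); exact: tauM_eqmod.
rewrite m_sum_rec; apply: tauM_eqmod.
apply: fps_eqmodD => //.
by do 4![apply: fps_eqmodD; last by apply: fps_eqmodM].
Qed.

(** * Sections of quotients of Euler products *)

Lemma quotient_exprM (R : comUnitRingType) (q x y : R) a b j :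
  x \is a GRing.unit -> y \is a GRing.unit -> (b <= 6 * j)%N -> (a <= 6 * j)%N ->
  x ^+ a / y ^+ b * (q * y ^+ 6 / x ^+ 6) ^+ j =
  q ^+ j * (y ^+ (6 * j - b) / x ^+ (6 * j - a)).
Proof.
move=> ux uy bj aj; rewrite exprMn exprVn exprMn -!exprM.
have uX k : x ^+ k \is a GRing.unit by rewrite unitrX.
have uY k : y ^+ k \is a GRing.unit by rewrite unitrX.
have -> : x ^+ (6 * j) = x ^+ (6 * j - a) * x ^+ a by rewrite -exprD subnK.
have -> : y ^+ (6 * j) = y ^+ (6 * j - b) * y ^+ b by rewrite -exprD subnK.
rewrite invrM//.
have := divrr (uX a); have := divrr (uY b).
move: (x ^+ a) (y ^+ b) ((x ^+ a)^-1) ((y ^+ b)^-1) => v w v' w' ew ev.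
transitivity (q ^+ j * (y ^+ (6 * j - b) / x ^+ (6 * j - a)) * (v * v') * (w * w')).
  by move: (y ^+ _) (x ^+ _)^-1 (q ^+ j) => p r t; ring.
by rewrite ev ew !mulr1.
Qed.

Lemma quotient_tau a b j : (b <= 6 * j)%N -> (a <= 6 * j)%N ->
  E 1 ^+ a / E 5 ^+ b * tau ^+ j = 'q^j * (E 5 ^+ (6 * j - b) / E 1 ^+ (6 * j - a)).
Proof.
move=> bj aj; have -> : 'q^j = 'q^1 ^+ j :> fps int by rewrite fps_qX mul1n.
by apply: quotient_exprM => //; apply: E_unit.
Qed.

Lemma dil_quotient_xi a b : (E 5 ^+ a / E 1 ^+ b) * 'q^b = dil (E 1 ^+ a / E 5 ^+ b) * xi ^+ b.
Proof.
rewrite -[E 1 ^+ a]mul1r (rmorph_fracX (@dil int)) ?E_unit//=.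
rewrite dil1 mul1r dil_E// dil_E//.
have -> : xi ^+ b = 'q^b * E 25 ^+ b / E 1 ^+ b by rewrite /xi exprMn exprVn exprMn fps_qX mul1n.
have e : E 25 ^+ b / E 25 ^+ b = 1 by rewrite divrr// unitrX ?E_unit.
move: (E 25 ^+ b) ((E 25 ^+ b)^-1) e => x x' e.
transitivity (E 5 ^+ a / E 1 ^+ b * 'q^b * (x * x')); first by rewrite e mulr1.
by move: (E 5 ^+ _) (E 1 ^+ _)^-1 ('q^b) => p r q; ring.
Qed.

(** Multiplication by q^(s + 5L) completes q^e to q^b, making the quotient a series in q^5 times
    xi^b; its section then expands in powers of tau. *)
Lemma sect_quotient L e s a b N n : (s + e + 5 * L = b)%N -> (5 * L < b)%N ->
    (b <= 6 * L.+1)%N -> (a <= 6 * L.+1)%N -> (s <= 5)%N -> (n.+2 <= N)%N ->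
  ('q^e * (E 5 ^+ a / E 1 ^+ b)) (5 * n + (5 - s))%N =
  \sum_(1 <= k < N) m b (L + k) *
    ('q^(k - 1) * (E 5 ^+ (6 * (L + k) - b) / E 1 ^+ (6 * (L + k) - a))) n.
Proof.
move=> hb Lb b6 a6 s5 nN; set G := 'q^e * _; pose K : fps int := E 1 ^+ a / E 5 ^+ b.
have dK : dil 'q^L * ('q^s * G) = dil K * xi ^+ b.
  rewrite -dil_quotient_xi dil_q /G -hb addnAC addnC fps_qD.
  by move: (E 5 ^+ _ / _) => x; rewrite fps_qD; ring.
have sK : 'q^L * sect 0 ('q^s * G) = K * sect_xi b.
  rewrite -(sect_dilM 'q^L)// dK sect_dilM//.
  by case: (b) Lb.
(* The shift by s moves the coefficient to 5(n + 1), hence to n + 1 in the section; the factor q^L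
   adds L. *)
have -> : G (5 * n + (5 - s))%N = (K * sect_xi b) (n.+1 + L)%N.
  rewrite -sK fps_coefMq ltnNge leq_addl/= addnK.
  transitivity (('q^s * G) (5 * n.+1 + 0)%N) => //.
  by rewrite fps_coefMq ifF; [congr (fps_coef G _)|]; lia.
transitivity ((K * \sum_(1 <= j < L + N) (m b j)%:~R * tau ^+ j) (n.+1 + L)%N).
  by apply: (@fps_eqmodM _ (L + N)) => //; [apply: sect_xi_eqmod|lia].
rewrite (big_cat_nat (n := L.+1)); [|lia..].
(* Since 5L < b, the entries [m b j] with j <= L vanish, and the sum starts at j = L + 1. *)
rewrite [X in _ * (X + _)]big_nat [X in _ * (X + _)]big1 ?add0r; last first.
  by move=> j jL; rewrite m_eq0 ?mul0r//; lia.
rewrite -[L.+1]add1n big_addn [(L + N)%N]addnC addnK mulr_sumr fps_coef_sum.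
apply: eq_big_nat => k /andP[k1 kN].
rewrite mulrCA fps_coef_intr intz [(k + L)%N]addnC quotient_tau; [|lia..].
have -> : (L + k = L.+1 + (k - 1))%N by lia.
rewrite [in 'q^_]fps_qD -mulrA fps_coefMq ifF; last by lia.
by congr (_ * fps_coef _ _); lia.
Qed.

(** * Iterated sections of the generating function *)

Lemma fps_cvg_eqmod (R : comNzRingType) (u : nat -> fps R) l n : fps_cvg u l ->
  exists N0, forall N, (N0 <= N)%N -> fps_eqmod n (u N) l.
Proof.
move=> ul; elim: n => [|n [N1 h1]]; first by exists 0%N.
have [N2 h2] := ul n; exists (maxn N1 N2) => N; rewrite geq_max => /andP[n1 n2] k.
by rewrite ltnS leq_eqVlt => /orP[/eqP->|]; [apply: h2|apply: h1].
Qed.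

(** Truncate both infinite products at a common index; there the factors cancel one by one. *)
Lemma p_E1 k : FPS (p_ (- k%:Z)) = E 1 ^- k.
Proof.
have uE : E 1 ^+ k \is a GRing.unit by rewrite unitrX ?E_unit.
apply: (mulIr uE); rewrite mulVr//; apply: fps_eqmod_eq => n.
have [N1 h1] := fps_cvg_eqmod n (p_cvg (- k%:Z)).
have [N2 h2] := fps_cvg_eqmod n (@E_cvg 1 isT).
apply: (fps_eqmod_trans (b := \prod_(1 <= i < maxn N1 N2) (1 - 'q^i) ^ (- k%:Z) *
   (\prod_(1 <= i < maxn N1 N2) (1 - 'q^(1 * i))) ^+ k)).
  apply: fps_eqmodM; first by apply/fps_eqmod_sym/h1; rewrite leq_maxl.
  by apply: fps_eqmodX; apply/fps_eqmod_sym/h2; rewrite leq_maxr.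
rewrite -prodrXl -big_split big_nat big1// => i /andP[i1 _].
rewrite mul1n -exprnN; apply: mulVr; rewrite unitrX//; apply: fps_unit1.
by rewrite fps_coefB/=; case: i i1.
Qed.

Lemma sum_ge1_coef (a : nat -> int) (d : nat -> fps int) n N : (n.+2 <= N)%N ->
  sum_ge1 (fun l => (a l)%:~R * 'q^(l - 1) * d l) n =
  \sum_(1 <= l < N) a l * ('q^(l - 1) * d l) n.
Proof.
move=> nN; have [N0 h] := sum_ge1_cvgMq a d n.
rewrite -(h (N0 + N)%N) ?leq_addr// fps_coef_sum (big_cat_nat (n := N)); [|lia..].
rewrite -[RHS]addr0; apply: congr2.
  by apply: eq_bigr => l _; rewrite -mulrA fps_coef_intr intz.
rewrite big_nat big1// => l lN.
by rewrite -mulrA fps_coef_intr fps_coefMq ifT ?mulr0//; lia.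
Qed.

Definition residue t : nat := (((if odd t then 13 else 17) * 5 ^ t + 7) %/ 24)%N.

(** [odd t] is read as 0 or 1, so one formula covers both parities. *)
Definition quotient t l : fps int :=
  'q^(l - 1) * (E 5 ^+ (6 * l - odd t) / E 1 ^+ (6 * l + 7 - odd t)).

(** By 5*17 - 13 = 3*24 and 5*13 - 17 = 2*24, the class extracted from level t is 3 for odd t and 2
    for even t. *)
Lemma residueS t : residue t.+1 = (5 ^ t * (if odd t then 3 else 2) + residue t)%N.
Proof.
by rewrite /residue expnS oddS; case: (odd t) => /=; move: (5 ^ t)%N => x; lia.
Qed.

Lemma p7_section t n N : (0 < t)%N -> (n.+2 <= N)%N ->
  p_ (- 7) (5 ^ t * n + residue t)%N = \sum_(1 <= l < N) c t l * quotient t l n.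
Proof.
case: t => // t _; elim: t n N => [|t IH] n N nN.
  transitivity (FPS (p_ (- 7%:Z)) (5 * n + (5 - 2))%N) => //.
  rewrite p_E1.
  transitivity (('q^0 * (E 5 ^+ 0 / E 1 ^+ 7)) (5 * n + (5 - 2))%N).
    by rewrite fps_q0 expr0 !mul1r.
  rewrite (@sect_quotient 1 0 2 0 7 N)//.
  apply: eq_big_nat => k /andP[k1 kN]; rewrite c1_m7// add1n.
  rewrite /quotient [odd 1]/=. congr (_ * fps_coef (_ * (_ ^+ _ / _ ^+ _)) _); lia.
set u := t.+1 in IH *.
have -> : (5 ^ u.+1 * n + residue u.+1 = 5 ^ u * (5 * n + (if odd u then 3 else 2)) + residue u)%N.
  by rewrite residueS expnS; lia.
(* Coefficient 5n + 3 at level u needs terms up to index 5n + 4, within the bound 5N. *)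
rewrite (IH _ (5 * N)%N); last by case: odd; lia.
transitivity (\sum_(1 <= l < 5 * N) \sum_(1 <= k < N)
   c u l * m (6 * l + (if odd u then 6 else 7)) (l + k + 1) * quotient u.+1 k n).
  apply: eq_big_nat => l /andP[l1 lN].
  (* With L = l + 1 the shift is s + (l - 1) + 5(l + 1), which is 6l + 6 for s = 2 and 6l + 7 for s
     = 3. *)
  have := @sect_quotient l.+1 (l - 1) (if odd u then 2 else 3) (6 * l - odd u)
    (6 * l + 7 - odd u) N n.
  have -> : (5 - (if odd u then 2 else 3) = if odd u then 3 else 2)%N by case: odd.
  rewrite /quotient oddS => ->; try by case: (odd u) => /=; lia.
  rewrite mulr_sumr; apply: eq_big_nat => k /andP[k1 kN]; rewrite -mulrA.
  by congr (_ * (m _ _ * fps_coef (_ * (_ ^+ _ / _ ^+ _)) _)); case: (odd u) => /=; lia.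
rewrite exchange_big_nat; apply: eq_big_nat => k /andP[k1 kN].
(* For l >= 5k the entry of [m] vanishes by [m_eq0], so the range 5N shrinks to the 5k of [cS]. *)
rewrite cS// mulr_suml [in LHS](big_cat_nat (n := (5 * k)%N)); [|lia..].
rewrite -[RHS]addr0; apply: congr2 => //; rewrite big_nat big1// => l lk.
by rewrite m_eq0 ?mulr0 ?mul0r//; case: odd; lia.
Qed.

Theorem theorem4p6 (j : nat) (hj : (1 <= j)%N) :
  FPS (fun n => p_ (- 7) (5 ^ (2 * j - 1) * n + (13 * 5 ^ (2 * j - 1) + 7) %/ 24)%N)
  = sum_ge1 (fun l => (c (2 * j - 1) l)%:~R * 'q^(l - 1)
                      * (E 5 ^+ (6 * l - 1) / E 1 ^+ (6 * l + 6)))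
  /\
  FPS (fun n => p_ (- 7) (5 ^ (2 * j) * n + (17 * 5 ^ (2 * j) + 7) %/ 24)%N)
  = sum_ge1 (fun l => (c (2 * j) l)%:~R * 'q^(l - 1)
                      * (E 5 ^+ (6 * l) / E 1 ^+ (6 * l + 7))).
Proof.
split; apply/fpsP => n; rewrite (sum_ge1_coef _ _ (leqnn _)).
  have o : odd (2 * j - 1) by lia.
  have := @p7_section (2 * j - 1) n n.+2; rewrite /residue /quotient o => e.
  rewrite [LHS]e//; last by lia.
  by apply: eq_big_nat => l _; rewrite -addnBA.
have o : odd (2 * j) = false by lia.
have := @p7_section (2 * j) n n.+2; rewrite /residue /quotient o => e.
rewrite [LHS]e//; last by lia.
by apply: eq_big_nat => l _; rewrite !subn0.
Qed.
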